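(* Let $\mathcal{H}$ be a $d$-dimensional Hilbert space and let $\mathscr{A}$ be a simple POVM on $\mathcal{H}$. Then the following five statements are equivalent. 1. $\mathscr{A}$ is a PVM. 2. $\mathscr{A}$ is universally Fisher sharp. 3. $\mathscr{A}$ is Fisher sharp at some $\rho\in\mathscr{D}(\mathcal{H})$. 4. $I_{\mathrm S}, I_{\mathrm L}, I_{\mathrm R}, \bar{\mathcal{F}}_{\mathrm S}, \bar{\mathcal{F}}_{\mathrm L}, \bar{\mathcal{F}}_{\mathrm R}, \mathcal{F}_{\mathrm S}, \mathcal{F}_{\mathrm L}, \mathcal{F}_{\mathrm R}$ (all associated with $\mathscr{A}$) are projectors at each $\rho\in\mathscr{D}(\mathcal{H})$. 5. One of the nine operators $I_{\mathrm S}, I_{\mathrm L}, I_{\mathrm R}, \bar{\mathcal{F}}_{\mathrm S}, \bar{\mathcal{F}}_{\mathrm L}, \bar{\mathcal{F}}_{\mathrm R}, \mathcal{F}_{\mathrm S}, \mathcal{F}_{\mathrm L}, \mathcal{F}_{\mathrm R}$ is a projector at some $\rho\in\mathscr{D}(\mathcal{H})$.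
   Context: $\mathcal{H}$ is a complex Hilbert space of finite dimension $d$; $\mathscr{D}(\mathcal{H})$ is the set of positive definite operators of trace 1 on $\mathcal{H}$. ''Projector'' means orthogonal projector. POVMs. A POVM on $\mathcal{H}$ is a finite family of positive semidefinite operators on $\mathcal{H}$ summing to the identity. A PVM is a POVM whose elements are projectors. A POVM is simple if every pair of its elements is linearly independent and it contains no zero element. Fisher information matrices. Near $\rho\in\mathscr{D}(\mathcal{H})$ choose a parametrization $\rho(\theta)\in\mathscr{D}(\mathcal{H})$ by $g=d^2-1$ real parameters $\theta$, differentiable and with linearly independent derivatives $\rho_{,a}:=\partial\rho(\theta)/\partial\theta_a$ (a basis of the real space of traceless Hermitian operators). For $\mathscr{A}=\{A_j\}_j$ put $p_j=\operatorname{tr}[\rho(\theta)A_j]$; $I(\theta,\mathscr{A})$ has entries $I_{ab}=\sum_{j:A_j\neq0}\frac{1}{p_j}\frac{\partial p_j}{\partial\theta_a}\frac{\partial p_j}{\partial\theta_b}$. $J_{\mathrm S}$ has entries $\frac12\operatorname{tr}[\rho(L_aL_b+L_bL_a)]$ with $L_a$ the Hermitian solution of $\frac12(\rho L_a+L_a\rho)=\rho_{,a}$; $J_{\mathrm R}$ is the Hermitian matrix with entries $\operatorname{tr}(\rho_{,a}\rho^{-1}\rho_{,b})$; $J_{\mathrm L}$ is the Hermitian matrix with entries $\operatorname{tr}(\rho_{,a}\rho_{,b}\rho^{-1})$. For $X\in\{\mathrm S,\mathrm L,\mathrm R\}$, $I_X=I_X(\theta,\mathscr{A}):=J_X^{-1/2}I(\theta,\mathscr{A})J_X^{-1/2}$;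 the spectra of these Hermitian matrices at a given $\rho$ do not depend on the parametrization. $\mathscr{A}$ is Fisher sharp at $\rho=\rho(\theta)$ if $I_{\mathrm S}(\theta,\mathscr{A})$ is a projector, and universally Fisher sharp if it is Fisher sharp at every $\rho\in\mathscr{D}(\mathcal{H})$. Superoperators. The operators on $\mathcal{H}$ form a Hilbert space with inner product $\langle\!\langle A|B\rangle\!\rangle=\operatorname{tr}(A^\dagger B)$; $|A\rangle\!\rangle$ denotes $A$ as a vector, and superoperators are linear maps on this space. $\bar{\mathbf I}$ is the orthogonal projector onto traceless operators. $\mathcal{F}=\mathcal{F}(\rho,\mathscr{A}):=\sum_{j:A_j\neq0}\frac{|A_j\rangle\!\rangle\langle\!\langle A_j|}{\operatorname{tr}(\rho A_j)}$ and $\bar{\mathcal{F}}:=\bar{\mathbf I}\mathcal{F}\bar{\mathbf I}$. $\mathcal{L}|A\rangle\!\rangle=|\rho A\rangle\!\rangle$, $\mathcal{R}|A\rangle\!\rangle=|A\rho\rangle\!\rangle$, $\mathcal{S}=(\mathcal{L}+\mathcal{R})/2$; $\mathcal{J}_{\mathrm L}=\mathcal{L}^{-1}$, $\mathcal{J}_{\mathrm R}=\mathcal{R}^{-1}$, $\mathcal{J}_{\mathrm S}=\mathcal{S}^{-1}$, and $\bar{\mathcal{J}}_X=\bar{\mathbf I}\mathcal{J}_X\bar{\mathbf I}$. For $X\in\{\mathrm S,\mathrm L,\mathrm R\}$, $\mathcal{F}_X:=\mathcal{J}_X^{-1/2}\mathcal{F}\mathcal{J}_X^{-1/2}$ and $\bar{\mathcal{F}}_X:=(\bar{\mathcal{J}}_X^{+})^{1/2}\bar{\mathcal{F}}(\bar{\mathcal{J}}_X^{+})^{1/2}$,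 where $^+$ is the Moore–Penrose inverse. *)

(* Defs.v *)
From HB Require Import structures.
From mathcomp Require Import all_boot all_order all_algebra.
From mathcomp Require Export sesquilinear spectral complex.
From mathcomp Require Import all_classical all_reals all_analysis.

Set Implicit Arguments.
Unset Strict Implicit.
Unset Printing Implicit Defensive.

Import Order.TTheory GRing.Theory Num.Theory.
Import numFieldNormedType.Exports.

Local Open Scope ring_scope.
Local Open Scope classical_set_scope.
Local Open Scope sesquilinear_scope.
Local Open Scope complex_scope.

(* The Hilbert space of dimension d is C^d with C := R[i], R : realType;
   operators on it are the matrices 'M[R[i]]_d. *)

Section Matrices.
Variable R : realType.
Local Notation C := R[i].

(* 0 <= z in R[i] includes that z is real, so these imply A \is hermsymmx. *)
Definition psdmx n (A : 'M[C]_n) : Prop :=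
  forall v : 'cV[C]_n, 0 <= (v ^t* *m A *m v) 0 0.

Definition posdefmx n (A : 'M[C]_n) : Prop :=
  forall v : 'cV[C]_n, v != 0 -> 0 < (v ^t* *m A *m v) 0 0.

Definition projector n (P : 'M[C]_n) : Prop :=
  P \is hermsymmx /\ P *m P = P.

(* Positive semidefinite square root; 0 (arbitrary) if A is not psd. *)
Definition sqrtmx n (A : 'M[C]_n) : 'M[C]_n :=
  xget 0 [set S | psdmx S /\ S *m S = A].

(* Moore-Penrose inverse. *)
Definition mpinvmx n (A : 'M[C]_n) : 'M[C]_n :=
  xget 0 [set X | [/\ A *m X *m A = A, X *m A *m X = X,
                      A *m X \is hermsymmx & X *m A \is hermsymmx]].

End Matrices.

Section States.
Variables (R : realType) (d : nat).
Local Notation C := R[i].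
Local Notation op := 'M[C]_d.

Definition density (rho : op) : Prop := posdefmx rho /\ \tr rho = 1.

Definition povm (I : finType) (A : I -> op) : Prop :=
  (forall j, psdmx (A j)) /\ \sum_j A j = 1%:M.

Definition pvm (I : finType) (A : I -> op) : Prop :=
  povm A /\ forall j, projector (A j).

Definition simple_povm (I : finType) (A : I -> op) : Prop :=
  [/\ povm A, forall j k, j != k -> free [:: A j; A k] & forall j, A j != 0].

End States.

Inductive variant := Sym | Left | Right.

Section FisherMatrix.
Variables (R : realType) (d : nat).
Local Notation C := R[i].
Local Notation op := 'M[C]_d.
Local Notation g := (d ^ 2).-1.
Local Notation params := 'rV[R]_g.

Definition mxRe (M : op) : 'M[R]_d := map_mx (@complex.Re R) M.
Definition mxIm (M : op) : 'M[R]_d := map_mx (@complex.Im R) M.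

(* 'M[R[i]]_d is not a normed module over R, hence the detour through real and
   imaginary parts. *)
Definition pderiv (r : params -> op) (theta : params) (a : 'I_g) : op :=
  map_mx (real_complex R) ('D_(delta_mx 0 a) (mxRe \o r) theta) +
  'i *: map_mx (real_complex R) ('D_(delta_mx 0 a) (mxIm \o r) theta).

(* The derivatives have to be independent over R, not over C. *)
Definition parametrization (r : params -> op) (theta : params) (rho : op) :
    Prop :=
  r theta = rho /\
  \forall t \near theta,
    [/\ density (r t),
        differentiable (mxRe \o r) t /\ differentiable (mxIm \o r) t
      & forall c : 'I_g -> R,
          \sum_a (c a)%:C *: pderiv r t a = 0 -> forall a, c a = 0].

Section Information.
Variables (r : params -> op) (theta : params).

(* The trace is real for Hermitian r t and M. *)
Definition outcome_prob (M : op) (t : params) : R :=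
  complex.Re (\tr (r t *m M)).

Definition fisher_info (I : finType) (A : I -> op) : 'M[R]_g :=
  \matrix_(a, b) \sum_(j | A j != 0)
    (outcome_prob (A j) theta)^-1
    * 'D_(delta_mx 0 a) (outcome_prob (A j)) theta
    * 'D_(delta_mx 0 b) (outcome_prob (A j)) theta.

(* Symmetric logarithmic derivative. *)
Definition sld (a : 'I_g) : op :=
  xget 0 [set L | L \is hermsymmx /\
    2^-1 *: (r theta *m L + L *m r theta) = pderiv r theta a].

Definition qfisher (X : variant) : 'M[C]_g :=
  let rho := r theta in
  \matrix_(a, b)
    match X with
    | Sym => 2^-1 * \tr (rho *m (sld a *m sld b + sld b *m sld a))
    | Left =>
        \tr (pderiv r theta a *m pderiv r theta b *m invmx rho)
    | Right =>
        \tr (pderiv r theta a *m invmx rho *m pderiv r theta b)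
    end.

Definition metric_fisher (X : variant) (I : finType) (A : I -> op) :
    'M[C]_g :=
  let K := sqrtmx (invmx (qfisher X)) in
  K *m map_mx (real_complex R) (fisher_info A) *m K.

Definition fisher_sharp (I : finType) (A : I -> op) : Prop :=
  projector (metric_fisher Sym A).

End Information.

(* Whether I_S is a projector does not depend on the parametrization near rho;
   here it is required for every one of them. *)
Definition universally_fisher_sharp (I : finType) (A : I -> op) : Prop :=
  forall rho, density rho ->
  forall r theta, parametrization r theta rho -> fisher_sharp r theta A.

End FisherMatrix.

Section Superoperators.
Variables (R : realType) (d : nat).
Local Notation C := R[i].
Local Notation op := 'M[C]_d.
(* Superoperators are matrices acting on the left of column vectors; mxvec
   turns the Hilbert-Schmidt inner product into the standard one, see braketE. *)
Local Notation super := 'M[C]_(d * d).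

Definition ket (A : op) : 'cV[C]_(d * d) := (mxvec A)^T.
Definition bra (A : op) : 'rV[C]_(d * d) := (ket A) ^t*.
Definition superop (f : op -> op) : super := (lin_mx f)^T.

Lemma braketE (A B : op) : bra A *m ket B = (\tr (A ^t* *m B))%:M.
Proof.
apply/matrixP => i j; rewrite !ord1 !mxE eqxx mulr1n.
rewrite (reindex _ (curry_mxvec_bij _ _)) /=.
pose F k l : C := (A k l)^* * B k l.
rewrite (eq_bigr (fun p => F p.1 p.2)); last first.
  by case=> k l _; rewrite /F !mxE !mxvecE.
rewrite -(pair_bigA _ F) exchange_big /=.
by apply: eq_bigr => l _; rewrite mxE; apply: eq_bigr => k _; rewrite !mxE.
Qed.

Lemma superopE (f : {linear op -> op}) A : superop f *m ket A = ket (f A).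
Proof. by rewrite -trmx_mul mul_vec_lin. Qed.

(* The traceless operators are the orthogonal complement of the identity. *)
Definition Ibar : super :=
  superop (fun A => A - (\tr A / d%:R) *: 1%:M).

Section AtState.
Variable rho : op.

Definition Fsuper (I : finType) (A : I -> op) : super :=
  \sum_(j | A j != 0) (\tr (rho *m A j))^-1 *: (ket (A j) *m bra (A j)).

Definition Fbar (I : finType) (A : I -> op) : super :=
  Ibar *m Fsuper A *m Ibar.

Definition Lsuper : super := superop (fun A => rho *m A).
Definition Rsuper : super := superop (fun A => A *m rho).
Definition Ssuper : super := 2^-1 *: (Lsuper + Rsuper).

Definition Jsuper (X : variant) : super :=
  invmx (match X with Sym => Ssuper | Left => Lsuper | Right => Rsuper end).

Definition Jbar (X : variant) : super := Ibar *m Jsuper X *m Ibar.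

Definition metric_F (X : variant) (I : finType) (A : I -> op) : super :=
  let K := sqrtmx (invmx (Jsuper X)) in K *m Fsuper A *m K.

Definition metric_Fbar (X : variant) (I : finType) (A : I -> op) : super :=
  let K := sqrtmx (mpinvmx (Jbar X)) in K *m Fbar A *m K.

End AtState.
End Superoperators.

(* Main.v *)
From HB Require Import structures.
Require Import Defs.
From mathcomp Require Import all_boot all_order all_algebra.
From mathcomp Require Import all_classical all_reals all_analysis.
From mathcomp Require Import ring.

Set Implicit Arguments.
Unset Strict Implicit.
Unset Printing Implicit Defensive.

Import Order.TTheory GRing.Theory Num.Theory.
Import numFieldNormedType.Exports.

(* Let S_X be the superoperator L, R or (L + R)/2, and F the superoperator of
   the POVM.  Each of the nine operators is K P K with K positive, and is a
   projector iff P K^2 P = P; since F|rho>> = |1>> and S_X|1>> = |rho>>, this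
   condition is F S_X F = F in all cases.  A PVM satisfies it because
   <<A_j|S_X|A_k>> is p_j if j = k and 0 otherwise.

   Conversely, F S_X F = F gives F S_X|A_j>> = |A_j>>, that is
   A_j = sum_k w_k A_k with w_k = <<A_k|S_X|A_j>>/p_k, and
   sum_k |w_k|^2 p_k = <<A_j|S_X|A_j>> = tr(rho A_j^2).  Hence the positive
   operator sum_k (w_k - A_j)^* A_k (w_k - A_j) = sum_k |w_k|^2 A_k - A_j^2 has
   zero trace against rho, so that A_k A_j = w_k A_k for every k.  Taking
   adjoints, pairwise linear independence forces A_k A_j = 0 for k <> j, and
   then A_j = A_j (sum_k A_k) = A_j^2. *)

Local Open Scope ring_scope.
Local Open Scope sesquilinear_scope.
Local Open Scope complex_scope.

(** * Adjoints, traces and quadratic forms of complex matrices *)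

Section Adjoint.
Variable C : numClosedFieldType.

Lemma trmxC_mul m n p (A : 'M[C]_(m, n)) (B : 'M[C]_(n, p)) :
  (A *m B)^t* = B^t* *m A^t*.
Proof. by rewrite trmx_mul map_mxM. Qed.

Lemma trmxC_add m n (A B : 'M[C]_(m, n)) : (A + B)^t* = A^t* + B^t*.
Proof. by rewrite linearD /= map_mxD. Qed.

Lemma trmxC_sub m n (A B : 'M[C]_(m, n)) : (A - B)^t* = A^t* - B^t*.
Proof. by rewrite linearB /= map_mxB. Qed.

Lemma trmxC_scale m n a (A : 'M[C]_(m, n)) : (a *: A)^t* = Num.conj a *: A^t*.
Proof. by rewrite linearZ /= map_mxZ. Qed.

Lemma trmxC_sum m n (I : Type) (r : seq I) (P : pred I)
    (A : I -> 'M[C]_(m, n)) :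
  (\sum_(i <- r | P i) A i)^t* = \sum_(i <- r | P i) (A i)^t*.
Proof.
apply/matrixP => i j; rewrite !(mxE, summxE) rmorph_sum.
by apply: eq_bigr => k _; rewrite !mxE.
Qed.

Lemma trmxC_scalar n (a : C) : (a%:M : 'M[C]_n)^t* = (Num.conj a)%:M.
Proof. by rewrite tr_scalar_mx map_scalar_mx. Qed.

Lemma hermsymmxP n (A : 'M[C]_n) : A \is hermsymmx <-> A^t* = A.
Proof.
split=> [/is_hermitianmxP|h]; first by rewrite expr0 scale1r.
by apply/is_hermitianmxP; rewrite expr0 scale1r h.
Qed.

Lemma trmxC_sandwich n (A B : 'M[C]_n) :
  A^t* = A -> B^t* = B -> (A *m B *m A)^t* = A *m B *m A.
Proof. by move=> hA hB; rewrite !trmxC_mul hA hB mulmxA. Qed.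

Lemma mxtrace_trmxC n (A : 'M[C]_n) : \tr (A^t*) = Num.conj (\tr A).
Proof. by rewrite /mxtrace rmorph_sum; apply: eq_bigr => i _; rewrite !mxE. Qed.

Lemma mxtrace_gram_ge0 m n (A : 'M[C]_(m, n)) : 0 <= \tr (A^t* *m A).
Proof.
apply: sumr_ge0 => i _; rewrite mxE; apply: sumr_ge0 => j _.
by rewrite !mxE mulrC mul_conjC_ge0.
Qed.

Lemma mxtrace_gram_eq0 m n (A : 'M[C]_(m, n)) : \tr (A^t* *m A) = 0 -> A = 0.
Proof.
have nneg i j : 0 <= A^t* i j * A j i by rewrite !mxE mulrC mul_conjC_ge0.
have nnegD i : 0 <= (A^t* *m A) i i by rewrite mxE sumr_ge0.
move=> tr0; apply/matrixP => j i; rewrite [RHS]mxE.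
have /(_ i isT) := psumr_eq0P (fun k _ => nnegD k) tr0.
rewrite mxE => /(psumr_eq0P (fun k _ => nneg i k))/(_ j isT)/eqP.
by rewrite !mxE mulrC mul_conjC_eq0 => /eqP.
Qed.

(** Polarization: expanding at [u + v] gives the symmetric relation [add], and replacing [u] by
    ['i *: u] flips a sign in it, so that both cross terms vanish. *)
Lemma quadratic_form_eq0 n (M : 'M[C]_n) :
  (forall v : 'cV[C]_n, v^t* *m M *m v = 0) -> M = 0.
Proof.
move=> h.
have add (u v : 'cV_n) : u^t* *m M *m v + v^t* *m M *m u = 0.
  have := h (u + v); rewrite trmxC_add !mulmxDl !mulmxDr !h addr0 add0r.
  by rewrite addrC.
have zero (u v : 'cV[C]_n) : u^t* *m M *m v = 0.
  have := add ('i *: u) v; rewrite trmxC_scale conjCi.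
  rewrite -!scalemxAl -!scalemxAr scaleNr -(subr0 (_ + _)).
  have /eqP := add u v; rewrite addrC addr_eq0 => /eqP ->.
  rewrite subr0 scalerN -opprD => /eqP; rewrite oppr_eq0 -scalerDl.
  rewrite scaler_eq0 => /orP[|/eqP//]; rewrite -mulr2n mulrn_eq0/=.
  by rewrite (negPf (neq0Ci _)).
apply/matrixP => i j; have /matrixP/(_ 0 0) := zero (delta_mx i 0) (delta_mx j 0).
rewrite trmx_delta map_delta_mx -rowE -colE !mxE => ->; by [].
Qed.

End Adjoint.

(** * Positive matrices: square roots, Gram factorizations, faithfulness of the trace *)

Section Positive.
Variable R : realType.
Local Notation C := R[i].

(** The values of the quadratic form are real, so [A] and its adjoint have the same quadratic form
    and agree by polarization. *)
Lemma psdmx_herm n (A : 'M[C]_n) : psdmx A -> A^t* = A.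
Proof.
move=> h; apply/subr0_eq/quadratic_form_eq0 => v.
rewrite mulmxBr mulmxBl (_ : _ *m A^t* *m v = (v^t* *m A *m v)^t*); last first.
  by rewrite !trmxC_mul trmxCK mulmxA.
rewrite [v^t* *m A *m v]mx11_scalar trmxC_scalar.
by rewrite (CrealP _) ?subrr// ger0_real.
Qed.

Lemma posdefmx_psd n (A : 'M[C]_n) : posdefmx A -> psdmx A.
Proof.
move=> h v; have [->|/h/ltW//] := eqVneq v 0.
by rewrite mulmx0 mxE.
Qed.

Lemma psdmx_congr m n (A : 'M[C]_n) (B : 'M[C]_(n, m)) :
  psdmx A -> psdmx (B^t* *m A *m B).
Proof. by move=> h v; have := h (B *m v); rewrite trmxC_mul !mulmxA. Qed.

Lemma psdmx_gram m n (B : 'M[C]_(m, n)) : psdmx (B^t* *m B).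
Proof.
move=> v; rewrite mulmxA -trmxC_mul -mulmxA -trace_mx11.
exact: mxtrace_gram_ge0.
Qed.

(** Once some positive square root exists, [xget] returns one. It is built from the spectral
    decomposition by taking square roots of the eigenvalues. *)
Lemma psdmx_sqrt n (A : 'M[C]_n) :
  psdmx A -> psdmx (sqrtmx A) /\ sqrtmx A *m sqrtmx A = A.
Proof.
move=> psdA; suff [S hS] : exists S, psdmx S /\ S *m S = A.
  exact: (@xgetPex _ 0 [set S | psdmx S /\ S *m S = A]%classic (ex_intro _ S hS)).
have /hermsymmxP/hermitian_normalmx/orthomx_spectralP/= := psdmx_herm psdA.
have := spectral_unitarymx A; move: (spectralmx A) (spectral_diag A) => P D Pu.
rewrite invmx_unitary// => eA.
have PP : P *m P^t* = 1%:M by apply/unitarymxP.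
(* The eigenvalue is the quadratic form of [A] at the corresponding eigenvector. *)
have D0 i : 0 <= D 0 i.
  have := psdA (P^t* *m delta_mx i 0); rewrite eA trmxC_mul trmxCK.
  rewrite !mulmxA -[_ *m P *m P^t*]mulmxA PP mulmx1.
  rewrite -[_ *m P *m P^t*]mulmxA PP mulmx1.
  rewrite trmx_delta map_delta_mx -rowE -colE !mxE eqxx mulr1n.
  by [].
have [Q [psdQ QQ]] : exists Q : 'M[C]_n, psdmx Q /\ Q *m Q = diag_mx D.
  exists (diag_mx (map_mx sqrtC D)); split; last first.
    rewrite mulmx_diag; congr diag_mx; apply/rowP => i.
    by rewrite !mxE -expr2 sqrtCK.
  (* Fourth roots of the eigenvalues exhibit the diagonal square root as a Gram matrix, which makes
     it positive. *)
  pose Q2 := diag_mx (map_mx (fun x => sqrtC (sqrtC x)) D).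
  have -> : diag_mx (map_mx sqrtC D) = Q2^t* *m Q2; last exact: psdmx_gram.
  rewrite tr_diag_mx map_diag_mx mulmx_diag; congr diag_mx.
  apply/rowP => i; rewrite !mxE -[in LHS](sqrtCK (sqrtC (D 0 i))) expr2.
  congr (_ * _); apply/esym/CrealP.
  by rewrite ger0_real // !sqrtC_ge0.
exists (P^t* *m Q *m P); split; first exact: psdmx_congr.
rewrite [RHS]eA; move: (diag_mx D) QQ => M <-.
by rewrite !mulmxA -(mulmxA _ P) PP mulmx1.
Qed.

Lemma psdmx_root n (A : 'M[C]_n) :
  psdmx A -> exists B : 'M[C]_n, A = B^t* *m B.
Proof.
move=> /psdmx_sqrt[/psdmx_herm h e]; exists (sqrtmx A).
by rewrite h e.
Qed.

(** The diagonal entries of the product are the values of the form of [A] at the columns of [B]. *)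
Lemma posdefmx_congr m n (A : 'M[C]_n) (B : 'M[C]_(n, m)) :
  posdefmx A -> B^t* *m A *m B = 0 -> B = 0.
Proof.
move=> pA h; apply/matrixP => i j; rewrite [RHS]mxE.
have [/matrixP/(_ i 0)|/pA] := eqVneq (col j B) 0; first by rewrite !mxE.
rewrite colE trmxC_mul !mulmxA -(mulmxA _ _ A) -(mulmxA _ _ B) h.
by rewrite mulmx0 mul0mx mxE ltxx.
Qed.

Lemma posdefmx_unit n (A : 'M[C]_n) : posdefmx A -> A \in unitmx.
Proof.
move=> pA; rewrite -row_free_unit -kermx_eq0; apply/eqP.
(* The rows of [kermx A] span the left kernel, so its adjoint plays the part of [B] in
   [posdefmx_congr]. *)
suff h : (kermx A)^t* = 0 by rewrite -[kermx A]trmxCK h trmx0 map_mx0.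
by apply: (posdefmx_congr pA); rewrite trmxCK mulmx_ker mul0mx.
Qed.

Lemma mxtrace_gram_gram m n p (A : 'M[C]_(p, n)) (B : 'M[C]_(m, n)) :
  \tr (A^t* *m A *m (B^t* *m B)) = \tr ((B *m A^t*)^t* *m (B *m A^t*)).
Proof. by rewrite trmxC_mul trmxCK -mulmxA mxtrace_mulC !mulmxA. Qed.

Lemma mxtrace_posdef_ge0 m n (A : 'M[C]_n) (B : 'M[C]_(m, n)) :
  posdefmx A -> 0 <= \tr (A *m (B^t* *m B)).
Proof.
move=> /posdefmx_psd/psdmx_root[S ->].
by rewrite mxtrace_gram_gram mxtrace_gram_ge0.
Qed.

(** Faithfulness of a positive definite state: with [A] the Gram matrix of [S], the trace is the
    squared norm of [B] times the adjoint of [S]. Hence [B *m A] vanishes, and [A] is invertible. *)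
Lemma mxtrace_posdef_eq0 m n (A : 'M[C]_n) (B : 'M[C]_(m, n)) :
  posdefmx A -> \tr (A *m (B^t* *m B)) = 0 -> B = 0.
Proof.
move=> pA; have [S eA] := psdmx_root (posdefmx_psd pA).
rewrite eA mxtrace_gram_gram => /mxtrace_gram_eq0 BS0.
by rewrite -(mulmxK (posdefmx_unit pA) B) eA mulmxA BS0 !mul0mx.
Qed.

End Positive.

(** * Moore-Penrose inverses and projectors of the form K P K *)

Section Projectors.
Variable R : realType.
Local Notation C := R[i].

(** Uniqueness of the Moore-Penrose inverse: for another candidate Y, taking adjoints gives A Y = A
    X and Y A = X A, whence Y = Y A Y = X A X = X. *)
Lemma mpinvmx_eq n (A X : 'M[C]_n) :
  A *m X *m A = A -> X *m A *m X = X ->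
  A *m X \is hermsymmx -> X *m A \is hermsymmx -> mpinvmx A = X.
Proof.
move=> h1 h2 s3 s4.
have [h3 h4] := ((hermsymmxP _).1 s3, (hermsymmxP _).1 s4).
have : [/\ A *m mpinvmx A *m A = A, mpinvmx A *m A *m mpinvmx A = mpinvmx A,
           A *m mpinvmx A \is hermsymmx & mpinvmx A *m A \is hermsymmx].
  exact: (@xgetPex _ 0 [set Y | [/\ A *m Y *m A = A, Y *m A *m Y = Y,
            A *m Y \is hermsymmx & Y *m A \is hermsymmx]]%classic
            (ex_intro _ X (And4 h1 h2 s3 s4))).
move: (mpinvmx A) => Y [g1 g2 /hermsymmxP g3 /hermsymmxP g4].
have AYX : A *m Y = A *m X.
  rewrite -g3 -{1}h1 -mulmxA trmxC_mul g3 h3.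
  by rewrite !mulmxA g1.
have YAX : Y *m A = X *m A.
  rewrite -g4 -{1}h1. rewrite !mulmxA -mulmxA trmxC_mul g4 h4.
  by rewrite -mulmxA [A *m (Y *m A)]mulmxA g1.
by rewrite -g2 YAX -mulmxA AYX mulmxA h2.
Qed.

(** [J] inverts [T] up to [E], which acts as an identity on [P]. Multiplying the idempotence of K P
    K by [K] on both sides gives T P T P T = T P T, and multiplying by [J] on both sides then
    removes the outer factors even if [K] is singular. *)
Lemma projector_sandwich n (K T J E P : 'M[C]_n) :
  K^t* = K -> K *m K = T -> J *m T = E -> T *m J = E -> E *m P = P ->
  P *m E = P -> P^t* = P -> projector (K *m P *m K) <-> P *m T *m P = P.
Proof.
move=> hK KK JT TJ EP PE hP; split=> [[_ h]|h].
  have {}h : T *m P *m T *m P *m T = T *m P *m T.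
    have := congr1 (fun M => K *m M *m K) h.
    by rewrite /= !mulmxA KK -!(mulmxA _ K K) !KK.
  have := congr1 (fun M => J *m M *m J) h.
  by rewrite /= -!mulmxA TJ PE !mulmxA JT EP.
split; first exact/hermsymmxP/trmxC_sandwich.
by rewrite -[in RHS]h -KK !mulmxA.
Qed.

End Projectors.

(** * Superoperators at a state *)

Section Kets.
Variables (R : realType) (d : nat).
Local Notation C := R[i].
Local Notation op := 'M[C]_d.
Implicit Types A B : op.

Lemma ketD A B : ket (A + B) = ket A + ket B.
Proof. by rewrite /ket !linearD. Qed.

Lemma ketN A : ket (- A) = - ket A.
Proof. by rewrite /ket !linearN. Qed.

Lemma ketZ a A : ket (a *: A) = a *: ket A.
Proof. by rewrite /ket !linearZ. Qed.

Lemma ket_sum (I : finType) (A : I -> op) : ket (\sum_j A j) = \sum_j ket (A j).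
Proof. by rewrite /ket !linear_sum. Qed.

Lemma ket0 : ket (0 : op) = 0.
Proof. by rewrite /ket !linear0. Qed.

Lemma ket_inj : injective (@ket R d).
Proof. by move=> A B /trmx_inj/(can_inj mxvecK). Qed.

Lemma ket_onto (v : 'cV[C]_(d * d)) : exists A, v = ket A.
Proof. by exists (vec_mx v^T); rewrite /ket vec_mxK trmxK. Qed.

Lemma ket_ext (M N : 'M[C]_(d * d)) :
  (forall A, M *m ket A = N *m ket A) -> M = N.
Proof.
move=> h; apply/matrixP => i j; have [A eA] := ket_onto (delta_mx j 0).
by have /matrixP/(_ i 0) := h A; rewrite -eA -!colE !mxE.
Qed.

Lemma trmxC_ket A : (ket A)^t* = bra A. Proof. by []. Qed.

Lemma trmxC_bra A : (bra A)^t* = ket A. Proof. exact: trmxCK. Qed.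

(** The identity operator has squared Hilbert-Schmidt norm [d], so this is the usual formula for
    projecting it out. The map in [Ibar] is first packed as a linear map so that [superopE]
    applies. *)
Lemma IbarE : Ibar R d = 1%:M - d%:R^-1 *: (ket 1%:M *m bra (1%:M : op)).
Proof.
pose f A : op := A - (\tr A / d%:R) *: 1%:M.
have lf : linear f.
  move=> a A B; rewrite /f mxtraceD mxtraceZ scalerBr scalerA mulrA.
  by rewrite mulrDl scalerDl opprD addrACA.
pose L := GRing.isLinear.Build _ _ _ _ f lf.
pose fl : {linear op -> op} := HB.pack f L.
apply: ket_ext => A; rewrite (superopE fl) /= /f ketD ketN ketZ.
rewrite mulmxBl mul1mx -scalemxAl -mulmxA braketE mul_mx_scalar.
by rewrite scalerA trmx1 map_mx1 mul1mx mulrC.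
Qed.

Lemma Ibar_herm : (Ibar R d)^t* = Ibar R d.
Proof.
rewrite IbarE trmxC_sub trmxC_scalar rmorph1 trmxC_scale trmxC_mul trmxC_bra.
by rewrite trmxC_ket fmorphV rmorph_nat.
Qed.

Lemma Ibar_traceless A : \tr A = 0 -> Ibar R d *m ket A = ket A.
Proof.
move=> h; rewrite IbarE mulmxBl mul1mx -scalemxAl -mulmxA braketE.
by rewrite trmx1 map_mx1 mul1mx h mul_mx_scalar scale0r scaler0 subr0.
Qed.

Hypothesis d_gt0 : (0 < d)%N.

Lemma Ibar1 : Ibar R d *m ket 1%:M = 0.
Proof.
rewrite IbarE mulmxBl mul1mx -scalemxAl -mulmxA braketE mul_mx_scalar.
rewrite trmx1 map_mx1 mul1mx mxtrace1 scalerA mulVf ?scale1r ?subrr//.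
by rewrite pnatr_eq0 -lt0n.
Qed.

Lemma Ibar_bra1 : bra 1%:M *m Ibar R d = 0.
Proof. by rewrite -Ibar_herm -trmxC_ket -trmxC_mul Ibar1 trmx0 map_mx0. Qed.

Lemma IbarK : Ibar R d *m Ibar R d = Ibar R d.
Proof.
rewrite {2}IbarE mulmxBr mulmx1 -scalemxAr mulmxA Ibar1 mul0mx.
by rewrite scaler0 subr0.
Qed.

End Kets.

(** * The superoperators S_X at a density and the compressions of their inverses *)

Section State.
Variables (R : realType) (d : nat).
Local Notation C := R[i].
Local Notation op := 'M[C]_d.
Implicit Types A B : op.
Variable rho : op.
Hypothesis rhoD : density rho.

Let rho_posdef : posdefmx rho := rhoD.1.
Let rho_herm : rho^t* = rho := psdmx_herm (posdefmx_psd rho_posdef).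

Definition Sop (X : variant) : 'M[C]_(d * d) :=
  match X with Sym => Ssuper rho | Left => Lsuper rho | Right => Rsuper rho end.

Lemma Lsuper_ket A : Lsuper rho *m ket A = ket (rho *m A).
Proof. exact: (superopE (mulmx rho)). Qed.

Lemma Rsuper_ket A : Rsuper rho *m ket A = ket (A *m rho).
Proof. exact: (superopE (mulmxr rho)). Qed.

Lemma Ssuper_ket A :
  Ssuper rho *m ket A = ket (2^-1 *: (rho *m A + A *m rho)).
Proof. by rewrite -scalemxAl mulmxDl Lsuper_ket Rsuper_ket ketZ ketD. Qed.

Lemma half_double (V : lmodType C) (x : V) : 2^-1 *: (x + x) = x.
Proof.
by rewrite -mulr2n -[x *+ 2]scaler_nat scalerA mulVf ?scale1r// pnatr_eq0.
Qed.

Lemma Sop_ket1 X : Sop X *m ket 1%:M = ket rho.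
Proof.
by case: X; rewrite ?Lsuper_ket ?Rsuper_ket ?Ssuper_ket ?mulmx1 ?mul1mx
  ?half_double.
Qed.

(** By cyclicity the form at [ket A] is the trace of [rho] times [A] times its adjoint, so
    faithfulness of [rho] applies. *)
Lemma Lsuper_posdef : posdefmx (Lsuper rho).
Proof.
move=> v; have [A ->] := ket_onto v => A0.
rewrite trmxC_ket -mulmxA Lsuper_ket braketE mxE eqxx mulr1n.
rewrite mxtrace_mulC -mulmxA -{1}[A]trmxCK lt_def mxtrace_posdef_ge0// andbT.
apply: contra_neq A0 => /mxtrace_posdef_eq0 => /(_ rho_posdef) h.
by rewrite -[A]trmxCK h trmx0 map_mx0 ket0.
Qed.

Lemma Rsuper_posdef : posdefmx (Rsuper rho).
Proof.
move=> v; have [A ->] := ket_onto v => A0.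
rewrite trmxC_ket -mulmxA Rsuper_ket braketE mxE eqxx mulr1n.
rewrite mulmxA mxtrace_mulC lt_def mxtrace_posdef_ge0// andbT.
by apply: contra_neq A0 => /mxtrace_posdef_eq0 => /(_ rho_posdef) ->; rewrite ket0.
Qed.

Lemma Sop_posdef X : posdefmx (Sop X).
Proof.
case: X => [v v0||]; [|exact: Lsuper_posdef|exact: Rsuper_posdef].
rewrite -scalemxAr -scalemxAl mulmxDr mulmxDl mxE [X in _ * X]mxE.
rewrite mulr_gt0 ?invr_gt0 ?ltr0n//.
by rewrite addr_gt0 //; [exact: Lsuper_posdef|exact: Rsuper_posdef].
Qed.

Lemma Sop_herm X : (Sop X)^t* = Sop X.
Proof. exact/psdmx_herm/posdefmx_psd/Sop_posdef. Qed.

Lemma JsuperE X : Jsuper rho X = invmx (Sop X). Proof. by case: X. Qed.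

Lemma SopJ X : Sop X *m Jsuper rho X = 1%:M.
Proof. by rewrite JsuperE mulmxV// posdefmx_unit//; exact: Sop_posdef. Qed.

Lemma JSop X : Jsuper rho X *m Sop X = 1%:M.
Proof. by rewrite JsuperE mulVmx// posdefmx_unit//; exact: Sop_posdef. Qed.

Lemma Jsuper_herm X : (Jsuper rho X)^t* = Jsuper rho X.
Proof.
rewrite -[LHS]mulmx1 -(SopJ X) mulmxA -{1}Sop_herm -trmxC_mul SopJ.
by rewrite trmxC_scalar rmorph1 mul1mx.
Qed.

Lemma Jsuper_rho X : Jsuper rho X *m ket rho = ket 1%:M.
Proof. by rewrite -(Sop_ket1 X) mulmxA JSop mul1mx. Qed.

Lemma bra1_ket_rho : bra 1%:M *m ket rho = 1%:M.
Proof. by rewrite braketE trmx1 map_mx1 mul1mx rhoD.2. Qed.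

Lemma bra_rho_ket1 : bra rho *m ket 1%:M = 1%:M.
Proof.
by rewrite -[RHS]bra1_ket_rho !braketE rho_herm trmx1 map_mx1 mulmx1 mul1mx.
Qed.

(* The Schur complement of S_X with respect to the identity operator, hence the
   inverse of the compression of S_X^-1 to the traceless operators. *)
Definition Tsuper (X : variant) : 'M[C]_(d * d) := Sop X - ket rho *m bra rho.

Lemma Tsuper_herm X : (Tsuper X)^t* = Tsuper X.
Proof. by rewrite trmxC_sub trmxC_mul Sop_herm trmxC_bra trmxC_ket. Qed.

Lemma Tsuper_ket1 X : Tsuper X *m ket 1%:M = 0.
Proof. by rewrite mulmxBl -mulmxA bra_rho_ket1 mulmx1 Sop_ket1 subrr. Qed.

Lemma Tsuper_Ibar X : Tsuper X *m Ibar R d = Tsuper X.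
Proof.
rewrite IbarE mulmxBr mulmx1 -scalemxAr mulmxA Tsuper_ket1 mul0mx.
by rewrite scaler0 subr0.
Qed.

Lemma Ibar_Tsuper X : Ibar R d *m Tsuper X = Tsuper X.
Proof.
by rewrite -{1}Ibar_herm -{1}Tsuper_herm -trmxC_mul Tsuper_Ibar Tsuper_herm.
Qed.

Hypothesis d_gt0 : (0 < d)%N.

(** Since S_X^-1|rho>> = |1>>, the product S_X^-1 T is the identity minus |1>><<rho|, and [Ibar]
    annihilates |1>>. *)
Lemma Jbar_Tsuper X : Jbar rho X *m Tsuper X = Ibar R d.
Proof.
rewrite /Jbar -mulmxA Ibar_Tsuper -mulmxA mulmxBr JSop mulmxA Jsuper_rho.
by rewrite mulmxBr mulmx1 mulmxA Ibar1// mul0mx subr0.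
Qed.

Lemma Jbar_herm X : (Jbar rho X)^t* = Jbar rho X.
Proof. by apply: trmxC_sandwich; [exact: Ibar_herm|exact: Jsuper_herm]. Qed.

Lemma Tsuper_Jbar X : Tsuper X *m Jbar rho X = Ibar R d.
Proof.
by rewrite -{1}Tsuper_herm -{1}Jbar_herm -trmxC_mul Jbar_Tsuper Ibar_herm.
Qed.

Lemma mpinv_Jbar X : mpinvmx (Jbar rho X) = Tsuper X.
Proof.
have hI : Ibar R d \is hermsymmx by apply/hermsymmxP/Ibar_herm.
apply: mpinvmx_eq; rewrite ?Jbar_Tsuper ?Tsuper_Jbar ?Ibar_Tsuper//.
by rewrite /Jbar !mulmxA IbarK.
Qed.

(** Two congruences carry positivity over from S_X: its inverse is S_X^-1 S_X S_X^-1, and T equals T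
    S_X^-1 T. *)
Lemma Tsuper_psd X : psdmx (Tsuper X).
Proof.
have -> : Tsuper X = (Tsuper X)^t* *m Jsuper rho X *m Tsuper X.
  rewrite -{1}Ibar_Tsuper -(Tsuper_Jbar X) /Jbar !mulmxA Tsuper_Ibar.
  by rewrite -!mulmxA Ibar_Tsuper !mulmxA Tsuper_herm.
apply: psdmx_congr.
have -> : Jsuper rho X = (Jsuper rho X)^t* *m Sop X *m Jsuper rho X.
  by rewrite Jsuper_herm JSop mul1mx.
exact/psdmx_congr/posdefmx_psd/Sop_posdef.
Qed.

(** * The superoperator of a simple POVM, and sharpness of PVMs *)

Section Povm.
Variables (I : finType) (A : I -> op).
Hypothesis simpleA : simple_povm A.

Let psdA j : psdmx (A j). Proof. by case: simpleA => -[]. Qed.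
Let sumA : \sum_j A j = 1%:M. Proof. by case: simpleA => -[]. Qed.
Let A_neq0 j : A j != 0. Proof. by case: simpleA. Qed.
Let A_herm j : (A j)^t* = A j. Proof. exact/psdmx_herm. Qed.

Local Notation p j := (\tr (rho *m A j)).

(** Treats the three variants at once: when left and right multiplication by [rho] give the same
    value, so does their mean. *)
Lemma braket_Sop X j B x : \tr (A j *m (rho *m B)) = x ->
  \tr (A j *m (B *m rho)) = x -> bra (A j) *m (Sop X *m ket B) = x%:M.
Proof.
move=> L R'; case: X.
- rewrite Ssuper_ket braketE A_herm -scalemxAr mxtraceZ mulmxDr mxtraceD L R'.
  by congr (_ %:M); exact: (@half_double C^o).
- by rewrite Lsuper_ket braketE A_herm L.
- by rewrite Rsuper_ket braketE A_herm R'.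
Qed.

Lemma outcome_gt0 j : 0 < p j.
Proof.
have [S e] := psdmx_root (psdA j).
rewrite lt_def e mxtrace_posdef_ge0// andbT.
have := A_neq0 j; apply: contra_neq => /mxtrace_posdef_eq0 => /(_ rho_posdef).
by rewrite e => ->; rewrite mulmx0.
Qed.

Let p_neq0 j : p j != 0. Proof. by rewrite gt_eqF ?outcome_gt0. Qed.

Lemma FsuperE : Fsuper rho A = \sum_j (p j)^-1 *: (ket (A j) *m bra (A j)).
Proof. by apply: eq_bigl => j; rewrite A_neq0. Qed.

Lemma Fsuper_herm : (Fsuper rho A)^t* = Fsuper rho A.
Proof.
rewrite FsuperE trmxC_sum; apply: eq_bigr => j _.
rewrite trmxC_scale trmxC_mul trmxC_bra trmxC_ket; congr (_ *: _).
by apply/CrealP; rewrite ger0_real// invr_ge0 ltW// outcome_gt0.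
Qed.

(** The overlap <<A_j|rho>> is p_j and cancels the weight, which leaves the sum of the POVM
    elements. *)
Lemma Fsuper_rho : Fsuper rho A *m ket rho = ket 1%:M.
Proof.
rewrite FsuperE mulmx_suml -sumA ket_sum; apply: eq_bigr => j _.
rewrite -scalemxAl -mulmxA braketE A_herm mul_mx_scalar scalerA.
by rewrite mxtrace_mulC mulVf ?scale1r// mxtrace_mulC p_neq0.
Qed.

(** The operators A_k A_i A_k sum to A_k over all i, and the term i = k is already A_k. The other
    terms are Gram matrices with total trace zero, so each vanishes. *)
Lemma pvm_ortho j k : pvm A -> j != k -> A j *m A k = 0.
Proof.
case=> _ projA jk.
have AA i : A i *m A i = A i by case: (projA i).
have gram i : (A i *m A k)^t* *m (A i *m A k) = A k *m A i *m A k.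
  by rewrite trmxC_mul !A_herm !mulmxA -(mulmxA _ (A i) (A i)) AA.
have : \sum_(i | i != k) \tr ((A i *m A k)^t* *m (A i *m A k)) = 0.
  have : \sum_i A k *m A i *m A k = A k.
    by rewrite -mulmx_suml -mulmx_sumr sumA mulmx1 AA.
  rewrite (bigD1 k)//= !AA => /(canRL (addKr _)); rewrite addNr => sum0.
  by rewrite -raddf_sum /= (eq_bigr _ (fun i _ => gram i)) sum0 raddf0.
move/psumr_eq0P => /(_ (fun i _ => mxtrace_gram_ge0 _))/(_ j jk).
exact: mxtrace_gram_eq0.
Qed.

Lemma pvm_braket X j k : pvm A ->
  bra (A j) *m (Sop X *m ket (A k)) = ((j == k)%:R * p k)%:M.
Proof.
move=> pvmA; have AA i : A i *m A i = A i by case: pvmA => _ /(_ i)[].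
have E : A j *m A k = (j == k)%:R *: A k.
  have [->|jk] := eqVneq; first by rewrite AA scale1r.
  by rewrite scale0r pvm_ortho.
have E' : A k *m A j = (j == k)%:R *: A k.
  by rewrite -[LHS]trmxCK trmxC_mul !A_herm E trmxC_scale A_herm rmorph_nat.
have L : \tr (A j *m (rho *m A k)) = (j == k)%:R * p k.
  by rewrite mxtrace_mulC -mulmxA E' -scalemxAr mxtraceZ.
have R' : \tr (A j *m (A k *m rho)) = (j == k)%:R * p k.
  by rewrite mulmxA E -scalemxAl mxtraceZ mxtrace_mulC.
exact: braket_Sop.
Qed.

Lemma pvm_sharp X : pvm A ->
  Fsuper rho A *m Sop X *m Fsuper rho A = Fsuper rho A.
Proof.
move=> pvmA; rewrite {2}FsuperE mulmx_sumr [RHS]FsuperE; apply: eq_bigr => k _.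
rewrite -scalemxAr mulmxA; congr (_ *: (_ *m _)).
rewrite FsuperE !mulmx_suml (bigD1 k)//= big1 => [|j /negPf jk].
  rewrite -!scalemxAl -!mulmxA pvm_braket// eqxx mul1r mul_mx_scalar scalerA.
  by rewrite mulVf// scale1r addr0.
by rewrite -!scalemxAl -!mulmxA pvm_braket// jk mul0r mul_mx_scalar scale0r scaler0.
Qed.

(** * From the identity F S_X F = F back to a PVM *)

Section Sharp.
Variable X : variant.
Hypothesis sharp : Fsuper rho A *m Sop X *m Fsuper rho A = Fsuper rho A.

(** With Y = F S_X - 1 the hypothesis says Y F = 0. The trace of Y F times the adjoint of Y is a sum
    of squared norms of Y|A_k>> with positive weights 1/p_k, so every Y|A_k>> vanishes. *)
Lemma sharp_fix j : Fsuper rho A *m Sop X *m ket (A j) = ket (A j).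
Proof.
pose Y := Fsuper rho A *m Sop X - 1%:M.
(* The double adjoint presents the rank-one matrix of Y|A_k>> as the Gram matrix of a row vector. *)
have gram k : 0 <= (p k)^-1 * \tr ((Y *m ket (A k))^t*^t* *m (Y *m ket (A k))^t*).
  by rewrite mulr_ge0 ?mxtrace_gram_ge0// invr_ge0 ltW// outcome_gt0.
have : \sum_k (p k)^-1 * \tr ((Y *m ket (A k))^t*^t* *m (Y *m ket (A k))^t*) = 0.
  have tr0 : \tr (Y *m Fsuper rho A *m Y^t*) = 0.
    by rewrite mulmxBl mul1mx sharp subrr mul0mx mxtrace0.
  rewrite -[RHS]tr0 FsuperE mulmx_sumr mulmx_suml raddf_sum /=.
  apply: eq_bigr => k _.
  rewrite -scalemxAr -scalemxAl mxtraceZ trmxCK trmxC_mul trmxC_ket.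
  by rewrite !mulmxA.
move/psumr_eq0P => /(_ (fun k _ => gram k))/(_ j isT)/eqP.
rewrite mulf_eq0 invr_eq0 (negPf (p_neq0 j)) /= => /eqP/mxtrace_gram_eq0.
move=> /(congr1 (fun M => M^t*)); rewrite trmxCK mulmxBl mul1mx trmx0 map_mx0.
by move/subr0_eq.
Qed.

(** The coefficients are <<A_i|S_X|A_j>>/p_i. Expanding F in F S_X|A_j>> = |A_j>> gives the first
    identity, and pairing this with <<A_j|S_X gives the second. *)
Lemma sharp_coef j : exists w : I -> C,
  \sum_i w i *: A i = A j /\
  \sum_i Num.conj (w i) * w i * p i = \tr (rho *m (A j *m A j)).
Proof.
pose c i := (bra (A i) *m (Sop X *m ket (A j))) 0 0.
have cE i : bra (A i) *m (Sop X *m ket (A j)) = (c i)%:M by exact: mx11_scalar.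
have cE' i : bra (A j) *m (Sop X *m ket (A i)) = (Num.conj (c i))%:M.
  by rewrite -trmxC_scalar -cE !trmxC_mul trmxC_ket trmxC_bra Sop_herm mulmxA.
have cj : bra (A j) *m (Sop X *m ket (A j)) = (\tr (rho *m (A j *m A j)))%:M.
  apply: braket_Sop; first by rewrite mxtrace_mulC mulmxA.
  by rewrite mulmxA mxtrace_mulC.
move: c cE cE' => c cE cE'.
exists (fun i => (p i)^-1 * c i); split.
  apply: ket_inj; rewrite ket_sum -[RHS]sharp_fix FsuperE !mulmx_suml.
  apply: eq_bigr => i _; rewrite -!scalemxAl -!mulmxA cE mul_mx_scalar scalerA.
  by rewrite ketZ.
have /matrixP/(_ 0 0) := cj; rewrite [X in _ = X -> _]mxE eqxx mulr1n => <-.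
rewrite -[in RHS]sharp_fix FsuperE !mulmx_suml !mulmx_sumr summxE.
apply: eq_bigr => i _; rewrite -!scalemxAl -!scalemxAr -(mulmxA _ (Sop X)).
rewrite -(mulmxA (ket _)) cE mul_mx_scalar -!scalemxAr cE' !mxE eqxx mulr1n.
have -> : Num.conj ((p i)^-1 * c i) = (p i)^-1 * Num.conj (c i).
  rewrite rmorphM fmorphV; congr (_^-1 * _); apply/CrealP.
  by rewrite ger0_real// ltW// outcome_gt0.
by rewrite mulrACA mulrAC divfK// (mulrC (c i)).
Qed.

(* The left-hand side is a sum of positive operators; it is the operator
   variance of the POVM with outcome values w. *)
Lemma povm_variance (w : I -> C) (B : op) :
  B^t* = B -> \sum_i w i *: A i = B ->
  \sum_i ((w i)%:M - B)^t* *m A i *m ((w i)%:M - B) =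
  \sum_i (Num.conj (w i) * w i) *: A i - B *m B.
Proof.
move=> hB eB.
have eB' : \sum_i Num.conj (w i) *: A i = B.
  rewrite -[RHS]hB -eB trmxC_sum; apply: eq_bigr => i _.
  by rewrite trmxC_scale A_herm.
have termE i : ((w i)%:M - B)^t* *m A i *m ((w i)%:M - B) =
    (Num.conj (w i) * w i) *: A i - Num.conj (w i) *: A i *m B -
    (B *m (w i *: A i) - B *m A i *m B).
  rewrite trmxC_sub trmxC_scalar hB mulmxBl mul_scalar_mx mulmxBl !mulmxBr.
  by rewrite !mul_mx_scalar scalerA -!scalemxAr (mulrC (w i)).
have s1 : \sum_i Num.conj (w i) *: A i *m B = B *m B by rewrite -mulmx_suml eB'.
have s2 : \sum_i B *m (w i *: A i) = B *m B by rewrite -mulmx_sumr eB.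
have s3 : \sum_i B *m A i *m B = B *m B.
  by rewrite -mulmx_suml -mulmx_sumr sumA mulmx1.
rewrite (eq_bigr _ (fun i _ => termE i)).
transitivity (\sum_i (Num.conj (w i) * w i) *: A i - B *m B -
              (B *m B - B *m B)); last by rewrite subrr subr0.
rewrite sumrB; congr (_ - _); rewrite sumrB; congr (_ - _).
- exact: s1.
- exact: s2.
- exact: s3.
Qed.

(* The variance of the coefficients of A j has zero expectation in rho, so it
   vanishes term by term. *)
Lemma sharp_mul j k : exists w, A k *m A j = w *: A k.
Proof.
have [w [eA wE]] := sharp_coef j; exists (w k).
pose Z i := (w i)%:M - A j.
(* Factoring every A_i as a Gram matrix turns each term of the variance into a Gram matrix, to which
   faithfulness of [rho] applies. *)
have [B BE] := choice (fun i => psdmx_root (psdA i)).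
have ZE i : (B i *m Z i)^t* *m (B i *m Z i) = (Z i)^t* *m A i *m Z i.
  by rewrite trmxC_mul BE !mulmxA.
have gram i : 0 <= \tr (rho *m ((B i *m Z i)^t* *m (B i *m Z i))).
  exact: mxtrace_posdef_ge0.
have : \sum_i \tr (rho *m ((B i *m Z i)^t* *m (B i *m Z i))) = 0.
  under eq_bigr do rewrite ZE.
  rewrite -raddf_sum -mulmx_sumr /= (povm_variance (A_herm j) eA) mulmxBr.
  rewrite raddfB /= -wE mulmx_sumr raddf_sum /=.
  apply/eqP; rewrite subr_eq0; apply/eqP; apply: eq_bigr => i _.
  by rewrite -scalemxAr mxtraceZ.
move/psumr_eq0P => /(_ (fun i _ => gram i))/(_ k isT) /mxtrace_posdef_eq0.
move=> /(_ rho_posdef) /(congr1 (mulmx ((B k)^t*))).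
by rewrite mulmxA -BE mulmx0 mulmxBr mul_mx_scalar => /subr0_eq.
Qed.

Lemma sharp_pvm : pvm A.
Proof.
have ortho i j : i != j -> A i *m A j = 0.
  move=> ij; have [c ec] := sharp_mul j i; have [c' ec'] := sharp_mul i j.
  (* A_j A_i is the adjoint of A_i A_j, so both scalars describe one operator. A nonzero [c] would
     make A_i a multiple of A_j, against simplicity. *)
  have : Num.conj c *: A i = c' *: A j.
    by rewrite -ec' -[A i in LHS]A_herm -trmxC_scale -ec trmxC_mul !A_herm.
  have [c0|c0] := eqVneq c 0; first by rewrite ec c0 scale0r.
  have cc0 : Num.conj c != 0 by rewrite conjC_eq0.
  move/(congr1 ( *:%R (Num.conj c)^-1)); rewrite !scalerA mulVf// scale1r => eA.
  have [_ /(_ i j ij)] := simpleA; rewrite free_cons span_seq1 eA.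
  by rewrite memvZ// memv_line.
split=> [|j]; first by case: simpleA.
split; first exact/hermsymmxP.
rewrite -[RHS]mulmx1 -sumA mulmx_sumr (bigD1 j)//= big1 ?addr0// => k kj.
by rewrite ortho// eq_sym.
Qed.

End Sharp.
End Povm.
End State.

(** The columns of [B] form a basis of the range of [E], not necessarily orthonormal, and [V] gives
    coordinates in it. The inverse of the compressed [J] is V T times the adjoint of V, which makes
    [projector_sandwich] applicable in coordinates; conjugating by [V] then returns to the full
    space. *)
Lemma projector_compression (R : realType) m n (B : 'M[complex R]_(n, m))
    (V : 'M[complex R]_(m, n)) (E J T P : 'M[complex R]_n) :
  V *m B = 1%:M -> B *m V = E -> E^t* = E -> J *m T = E -> psdmx T ->
  E *m T = T -> T *m E = T -> P^t* = P -> E *m P = P -> P *m E = P ->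
  let K := sqrtmx (invmx (B^t* *m J *m B)) in
  projector (K *m (B^t* *m P *m B) *m K) <-> P *m T *m P = P.
Proof.
move=> VB BV hE JT psdT ET TE hP EP PE /=.
have VB' : B^t* *m V^t* = 1%:M by rewrite -trmxC_mul VB trmxC_scalar rmorph1.
have BV' : V^t* *m B^t* = E by rewrite -trmxC_mul BV hE.
have BE : B^t* *m E = B^t* by rewrite -BV' mulmxA VB' mul1mx.
have JN : (B^t* *m J *m B) *m (V *m T *m V^t*) = 1%:M.
  by rewrite !mulmxA -(mulmxA _ B) BV -(mulmxA _ E) ET -(mulmxA _ J) JT BE.
have -> : invmx (B^t* *m J *m B) = V *m T *m V^t*.
  have [uJ _] := mulmx1_unit JN.
  by rewrite -[LHS]mulmx1 -JN mulKmx.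
have psdN : psdmx (V *m T *m V^t*).
  by rewrite -{1}[V]trmxCK; exact: psdmx_congr.
have [psdK KK] := psdmx_sqrt psdN.
rewrite (projector_sandwich (psdmx_herm psdK) KK JN (mulmx1C JN)) ?mul1mx//;
  rewrite ?mulmx1//; last by rewrite !trmxC_mul trmxCK hP mulmxA.
have -> : B^t* *m P *m B *m (V *m T *m V^t*) *m (B^t* *m P *m B) =
          B^t* *m (P *m T *m P) *m B.
  rewrite !mulmxA -(mulmxA _ B) BV -(mulmxA _ (V^t*)) BV'.
  by rewrite -(mulmxA _ T E) TE -(mulmxA _ E T) ET.
split=> [h|->//]; have := congr1 (fun M => V^t* *m M *m V) h.
rewrite /= !mulmxA BV' -!(mulmxA _ B) BV EP -!mulmxA.
by rewrite PE.
Qed.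

(** * Reduction of the three kinds of operators to F S F = F *)

Section Metrics.
Variables (R : realType) (d : nat).
Local Notation C := R[i].
Local Notation op := 'M[C]_d.
Hypothesis d_gt0 : (0 < d)%N.
Variable rho : op.
Hypothesis rhoD : density rho.
Variables (I : finType) (A : I -> op).
Hypothesis simpleA : simple_povm A.

Local Notation F := (Fsuper rho A).
Local Notation T := (Tsuper rho).

Definition sharp X := F *m Sop rho X *m F = F.

Lemma metric_F_sharp X : projector (metric_F rho X A) <-> sharp X.
Proof.
have [psdK KK] := psdmx_sqrt (posdefmx_psd (Sop_posdef rhoD X)).
rewrite /metric_F JsuperE invmxK.
apply: (projector_sandwich (J := Jsuper rho X) (E := 1%:M)) => //.
- exact: psdmx_herm.
- exact: JSop.
- exact: SopJ.
- exact: mul1mx.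
- exact: mulmx1.
- exact: Fsuper_herm.
Qed.

Lemma Fbar_herm : (Fbar rho A)^t* = Fbar rho A.
Proof. by apply: trmxC_sandwich; [exact: Ibar_herm|exact: Fsuper_herm]. Qed.

(** Let D = F S_X F - F. The rank-one correction in T is sent by F to |1>>, which [Ibar] kills, so
    the two sides on the left differ by the compression of D. Nothing is lost in compressing, since
    D also annihilates |rho>>, which is not traceless. *)
Lemma Fbar_sharp X : Fbar rho A *m T X *m Fbar rho A = Fbar rho A <-> sharp X.
Proof.
pose D := F *m Sop rho X *m F - F.
have Frho := Fsuper_rho rhoD simpleA.
have Fherm := Fsuper_herm rhoD simpleA.
have rhoF : bra rho *m F = bra 1%:M.
  by rewrite -Fherm -trmxC_ket -trmxC_mul Frho.
have Drho : D *m ket rho = 0.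
  by rewrite mulmxBl -!mulmxA Frho Sop_ket1// Frho subrr.
have Dherm : D^t* = D.
  by rewrite trmxC_sub !trmxC_mul Fherm Sop_herm// mulmxA.
have rhoD0 : bra rho *m D = 0.
  by rewrite -Dherm -trmxC_ket -trmxC_mul Drho trmx0 map_mx0.
have E : Fbar rho A *m T X *m Fbar rho A - Fbar rho A = Ibar R d *m D *m Ibar R d.
  rewrite /Fbar !mulmxA -(mulmxA _ _ (T X)) Ibar_Tsuper//.
  rewrite -(mulmxA _ (T X) (Ibar R d)) Tsuper_Ibar// /Tsuper.
  rewrite mulmxBr !mulmxBl mulmxBr mulmxBl !mulmxA.
  by rewrite -(mulmxA _ F (ket rho)) Frho Ibar1// !mul0mx subr0.
rewrite /sharp; split=> /eqP; rewrite -subr_eq0 ?E -/D => /eqP D0; last first.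
  by apply/subr0_eq; rewrite E D0 mulmx0 mul0mx.
apply: subr0_eq; rewrite -/D.
(* The oblique projection onto traceless operators along [rho]; it satisfies D = D Q and has
   traceless values, so D is recovered from its compression. *)
pose Q : 'M[C]_(d * d) := 1%:M - ket rho *m bra 1%:M.
have DQ : D = D *m Q by rewrite mulmxBr mulmx1 mulmxA Drho mul0mx subr0.
have IQ : Ibar R d *m Q = Q.
  rewrite IbarE mulmxBl mul1mx -scalemxAl -mulmxA mulmxBr mulmx1 mulmxA.
  by rewrite bra1_ket_rho// mul1mx subrr mulmx0 scaler0 subr0.
rewrite DQ -Dherm [in LHS]DQ trmxC_mul Dherm -IQ trmxC_mul Ibar_herm.
rewrite -!mulmxA (mulmxA D) (mulmxA (Ibar R d)) (mulmxA (Ibar R d)) D0.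
by rewrite mul0mx mulmx0.
Qed.

Lemma metric_Fbar_sharp X : projector (metric_Fbar rho X A) <-> sharp X.
Proof.
have [psdK KK] := psdmx_sqrt (Tsuper_psd rhoD d_gt0 X).
rewrite -Fbar_sharp /metric_Fbar mpinv_Jbar//.
apply: (projector_sandwich (J := Jbar rho X) (E := Ibar R d)) => //.
- exact: psdmx_herm.
- exact: Jbar_Tsuper.
- exact: Tsuper_Jbar.
- by rewrite /Fbar !mulmxA IbarK.
- by rewrite /Fbar -!mulmxA IbarK.
- exact: Fbar_herm.
Qed.

(** * Coordinates with respect to independent traceless Hermitian operators *)

Section Frame.
Local Notation g := (d ^ 2).-1.
Variable D : 'I_g -> op.
Hypotheses (hermD : forall a, (D a)^t* = D a) (trD : forall a, \tr (D a) = 0).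
Hypothesis freeD : forall c : 'I_g -> R,
  \sum_a (c a)%:C *: D a = 0 -> forall a, c a = 0.

Definition frame : 'M[C]_(d * d, g) := \matrix_(i, a) ket (D a) i 0.

Lemma col_frame a : col a frame = ket (D a).
Proof. by apply/colP => i; rewrite !mxE. Qed.

Lemma frame_gramE (M : 'M[C]_(d * d)) a b :
  (frame^t* *m M *m frame) a b = (bra (D a) *m M *m ket (D b)) 0 0.
Proof.
have -> : bra (D a) = (col a frame)^t* by rewrite col_frame.
rewrite -col_frame !colE trmxC_mul trmx_delta map_delta_mx -!mulmxA -rowE.
by rewrite [RHS]mxE !mulmxA -colE [RHS]mxE.
Qed.

Lemma Ibar_frame : Ibar R d *m frame = frame.
Proof.
apply/matrixP => i a; have := Ibar_traceless (trD a).
by rewrite -col_frame colE mulmxA -!colE => /colP/(_ i); rewrite !mxE.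
Qed.

(** Independence passes from real to complex scalars: the adjoint of a vanishing combination of
    Hermitian operators has conjugate coefficients, so the real and the imaginary parts of the
    coefficients each give a vanishing real combination. *)
Lemma frame_free (c : 'cV[C]_g) : frame *m c = 0 -> c = 0.
Proof.
move=> h; have {h} sum0 : \sum_a c a 0 *: D a = 0.
  apply: ket_inj; rewrite ket_sum ket0 -[RHS]h; apply/colP => i.
  rewrite summxE mxE; apply: eq_bigr => a _.
  by rewrite ketZ [in RHS]mxE mxE mulrC.
have sum0' : \sum_a Num.conj (c a 0) *: D a = 0.
  rewrite -[RHS](trmxCK 0) trmx0 map_mx0 -[X in X^t*]sum0 trmxC_sum.
  by apply: eq_bigr => a _; rewrite trmxC_scale hermD.
apply/colP => a; rewrite mxE [c a 0]complexE.
have -> : complex.Re (c a 0) = 0.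
  apply: (freeD (c := fun b => complex.Re (c b 0))).
  rewrite (_ : \sum_b _ = 2^-1 *: (\sum_b c b 0 *: D b +
                                  \sum_b Num.conj (c b 0) *: D b)).
    by rewrite sum0 sum0' addr0 scaler0.
  rewrite -big_split scaler_sumr; apply: eq_bigr => b _ /=.
  by rewrite -scalerDl scalerA complexRe ReE mulrC.
have -> : complex.Im (c a 0) = 0.
  apply: (freeD (c := fun b => complex.Im (c b 0))).
  rewrite (_ : \sum_b _ = ('i / 2) *: (\sum_b Num.conj (c b 0) *: D b -
                                       \sum_b c b 0 *: D b)).
    by rewrite sum0 sum0' subr0 scaler0.
  rewrite -sumrB scaler_sumr; apply: eq_bigr => b _ /=.
  by rewrite -scalerBl scalerA complexIm ImE mulrAC.
by rewrite mulr0 addr0.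
Qed.

(** A dimension count: the g = d^2 - 1 independent columns lie in the range of [Ibar] and therefore
    span it. *)
Lemma frame_inv : exists2 V : 'M[C]_(g, d * d),
  V *m frame = 1%:M & frame *m V = Ibar R d.
Proof.
have rf : row_free frame^T.
  apply: inj_row_free => v h; apply: trmx_inj; rewrite trmx0.
  by apply: frame_free; rewrite -[_ *m _]trmxK trmx_mul trmxK h trmx0.
have sub : (frame^T <= (Ibar R d)^T)%MS.
  by rewrite -{1}Ibar_frame trmx_mul submxMl.
(* The rank falls short of d^2 because <<1| is annihilated by [Ibar] and is nonzero, its pairing
   with |rho>> being 1. *)
have rk : (\rank (Ibar R d)^T <= g)%N.
  rewrite mxrank_tr -mulnn -ltnS prednK ?muln_gt0 ?d_gt0//.
  rewrite ltn_neqAle rank_leq_row andbT.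
  apply/negP => /row_free_inj inj.
  have : bra 1%:M = 0 :> 'rV[C]_(d * d) by apply: inj; rewrite Ibar_bra1// mul0mx.
  move/(congr1 (mulmx^~ (ket rho))); rewrite bra1_ket_rho// mul0mx.
  by move/matrixP/(_ 0 0); rewrite !mxE => /eqP; rewrite oner_eq0.
have [_] := mxrank_leqif_sup sub.
rewrite (eqP rf) => e; have : ((Ibar R d)^T <= frame^T)%MS.
  by rewrite -e eqn_leq rk andbT -{1}(eqP rf) mxrankS.
move=> /submxP[W hW]; have fW : frame *m W^T = Ibar R d.
  by apply: trmx_inj; rewrite trmx_mul trmxK hW.
exists W^T => //; apply: trmx_inj; apply: (row_free_inj rf).
by rewrite -!trmx_mul mulmxA fW Ibar_frame mulmx1.
Qed.

(** The frame consists of traceless operators and only sees compressions by [Ibar], so S_X^-1 and F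
    may be replaced by [Jbar] and [Fbar]. *)
Lemma frame_sharp X :
  let K := sqrtmx (invmx (frame^t* *m Jsuper rho X *m frame)) in
  projector (K *m (frame^t* *m F *m frame) *m K) <-> sharp X.
Proof.
have [V Vf fV] := frame_inv.
have fI : frame^t* *m Ibar R d = frame^t*.
  by rewrite -{1}Ibar_herm -trmxC_mul Ibar_frame.
have compress M : frame^t* *m M *m frame =
    frame^t* *m (Ibar R d *m M *m Ibar R d) *m frame.
  by rewrite -{1}fI -{2}Ibar_frame !mulmxA.
rewrite /= -Fbar_sharp (compress (Jsuper rho X)) (compress F).
apply: (projector_compression Vf fV).
- exact: Ibar_herm.
- exact: Jbar_Tsuper.
- exact: Tsuper_psd.
- exact: Ibar_Tsuper.
- exact: Tsuper_Ibar.
- exact: Fbar_herm.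
- by rewrite !mulmxA IbarK.
- by rewrite -!mulmxA IbarK.
Qed.

End Frame.
End Metrics.

(** * Fisher information of a parametrization *)

Section Parametrization.
Variables (R : realType) (d : nat).
Local Notation C := R[i].
Local Notation op := 'M[C]_d.
Local Notation g := (d ^ 2).-1.
Variables (r : 'rV[R]_g -> op) (theta : 'rV[R]_g) (rho : op).
Hypothesis param : parametrization r theta rho.

Let r_theta : r theta = rho := param.1.

Local Notation D := (pderiv r theta).
Local Notation dir a := (delta_mx 0 a : 'rV[R]_g).

Lemma parametrization_density : density rho.
Proof. by case: param => <- /nbhs_singleton[]. Qed.

Lemma pderiv_free (c : 'I_g -> R) :
  \sum_a (c a)%:C *: D a = 0 -> forall a, c a = 0.
Proof. by case: param => _ /nbhs_singleton[_ _]; apply. Qed.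

Lemma Re_pderivE a i j :
  complex.Re (D a i j) = 'D_(dir a) (@mxRe R d \o r) theta i j.
Proof. by rewrite !mxE /= !mul0r mul1r oppr0 !addr0. Qed.

Lemma Im_pderivE a i j :
  complex.Im (D a i j) = 'D_(dir a) (@mxIm R d \o r) theta i j.
Proof. by rewrite !mxE /= !mul0r mul1r !add0r. Qed.

Lemma is_derive_Re a i j :
  is_derive theta (dir a) (fun t => complex.Re (r t i j)) (complex.Re (D a i j)).
Proof.
have [_ /nbhs_singleton[_ [dRe _] _]] := param.
have e : (fun t => complex.Re (r t i j)) = (fun t => (@mxRe R d \o r) t i j).
  by apply/funext => t; rewrite !mxE.
have dm := diff_derivable (v := dir a) dRe.
rewrite e Re_pderivE derive_mx// mxE; apply: derivableP.
exact: (derivable_mxP _ _ _).1.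
Qed.

Lemma is_derive_Im a i j :
  is_derive theta (dir a) (fun t => complex.Im (r t i j)) (complex.Im (D a i j)).
Proof.
have [_ /nbhs_singleton[_ [_ dIm] _]] := param.
have e : (fun t => complex.Im (r t i j)) = (fun t => (@mxIm R d \o r) t i j).
  by apply/funext => t; rewrite !mxE.
have dm := diff_derivable (v := dir a) dIm.
rewrite e Im_pderivE derive_mx// mxE; apply: derivableP.
exact: (derivable_mxP _ _ _).1.
Qed.

(** The probability is a fixed real linear combination of the real and imaginary parts of the
    entries of [r t], so it is differentiated entry by entry. *)
Lemma derive_outcome_prob a (M : op) :
  'D_(dir a) (outcome_prob r M) theta = complex.Re (\tr (D a *m M)).
Proof.
have trE (N : op) : complex.Re (\tr (N *m M)) =
    \sum_i \sum_k (complex.Re (M k i) *: complex.Re (N i k) -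
                   complex.Im (M k i) *: complex.Im (N i k)).
  rewrite raddf_sum; apply: eq_bigr => i _; rewrite mxE raddf_sum.
  apply: eq_bigr => k _; case: (N i k) (M k i) => [x y] [z t] /=.
  by rewrite /GRing.scale /= mulrC (mulrC y).
have -> : outcome_prob r M =
    \sum_i \sum_k (complex.Re (M k i) \*: (fun t => complex.Re (r t i k)) -
                   complex.Im (M k i) \*: (fun t => complex.Im (r t i k))).
  apply/funext => t; rewrite /outcome_prob trE fct_sumE; apply: eq_bigr => i _.
  by rewrite fct_sumE.
rewrite trE; apply: derive_val; apply: is_derive_sum => i.
apply: is_derive_sum => k.
by apply: is_deriveB; apply: is_deriveZ; [exact: is_derive_Re|exact: is_derive_Im].
Qed.

(** [r t] is a density, hence Hermitian, on a whole neighbourhood of [theta]; mirrored entries are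
    thus conjugate there, and derivatives only depend on values near [theta]. *)
Lemma pderiv_herm a : (D a)^t* = D a.
Proof.
have herm : \forall t \near theta, (r t)^t* = r t.
  have [_ near] := param; apply: filterS near => t [[pos _] _ _].
  exact/psdmx_herm/posdefmx_psd.
apply/matrixP => i j; transitivity (Num.conj (D a j i)); first by rewrite !mxE.
apply/eqP; rewrite eq_complex; apply/andP; split; apply/eqP.
  transitivity (complex.Re (D a j i)); first by case: (D a j i).
  rewrite -[LHS](@derive_val _ _ _ _ _ _ _ (is_derive_Re a j i)).
  rewrite -[RHS](@derive_val _ _ _ _ _ _ _ (is_derive_Re a i j)).
  apply: near_eq_derive; apply: filterS herm => t h.
  by rewrite -{1}h !mxE; case: (r t i j).
transitivity (- complex.Im (D a j i)); first by case: (D a j i).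
rewrite -[X in - X](@derive_val _ _ _ _ _ _ _ (is_derive_Im a j i)).
rewrite -[RHS](@derive_val _ _ _ _ _ _ _ (is_derive_Im a i j)).
rewrite -deriveN; last exact: (@ex_derive _ _ _ _ _ _ _ (is_derive_Im a j i)).
apply: near_eq_derive; apply: filterS herm => t h.
rewrite -[in RHS]h !mxE.
change (- complex.Im (r t j i) = complex.Im (Num.conj (r t j i))).
by case: (r t j i).
Qed.

Lemma tr_herm_real (M N : op) : M^t* = M -> N^t* = N -> \tr (M *m N) \is Num.real.
Proof.
by move=> hM hN; apply/CrealP; rewrite -mxtrace_trmxC trmxC_mul hM hN mxtrace_mulC.
Qed.

(** The trace is the derivative of the probability of the identity operator, which is constantly 1
    near [theta]. *)
Lemma pderiv_traceless a : \tr (D a) = 0.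
Proof.
rewrite -[D a]mulmx1 -[LHS]RRe_real; last first.
  by rewrite tr_herm_real ?pderiv_herm// trmxC_scalar rmorph1.
rewrite -derive_outcome_prob (_ : 'D_(dir a) _ _ = 0)//.
rewrite (@near_eq_derive _ _ _ _ (cst (1 : R^o))) ?derive_cst//.
have [_ near] := param; apply: filterS near => t [[_ tr1] _ _].
by rewrite /outcome_prob mulmx1 tr1.
Qed.

Let rhoD := parametrization_density.
Let rho_herm : rho^t* = rho := psdmx_herm (posdefmx_psd rhoD.1).

(** Cyclicity of the trace. For [M] equal to [rho] it identifies the entry of the symmetric Fisher
    matrix with <<L|S|N>>, for Hermitian [L]. *)
Lemma mxtrace_anticomm (M L N : op) :
  2^-1 * \tr (M *m (L *m N + N *m L)) = \tr (L *m (2^-1 *: (M *m N + N *m M))).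
Proof.
rewrite -[in RHS]scalemxAr [RHS]mxtraceZ !mulmxDr !mxtraceD; congr (_ * _).
rewrite addrC; congr (_ + _); first by rewrite [RHS]mxtrace_mulC mulmxA.
by rewrite [in RHS]mulmxA [RHS]mxtrace_mulC.
Qed.

Lemma SsuperJ (N : op) : Ssuper rho *m (Jsuper rho Sym *m ket N) = ket N.
Proof. by rewrite mulmxA (SopJ rhoD Sym) mul1mx. Qed.

(** S is invertible, so the defining equation has exactly one solution. The adjoint of the solution
    solves it too, [rho] and [D a] being Hermitian; hence the solution is Hermitian and serves as a
    witness for [xget]. *)
Lemma sldP a : (sld r theta a)^t* = sld r theta a /\
  ket (sld r theta a) = Jsuper rho Sym *m ket (D a).
Proof.
have inj (L : op) : 2^-1 *: (rho *m L + L *m rho) = D a ->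
    ket L = Jsuper rho Sym *m ket (D a).
  by move=> <-; rewrite -Ssuper_ket mulmxA (JSop rhoD Sym) mul1mx.
have [L eL] := ket_onto (Jsuper rho Sym *m ket (D a)).
have LD : 2^-1 *: (rho *m L + L *m rho) = D a.
  by apply: ket_inj; rewrite -Ssuper_ket -eL SsuperJ.
have Lherm : L^t* = L.
  apply: ket_inj; rewrite -eL; apply: inj.
  rewrite -[RHS]pderiv_herm -LD trmxC_scale trmxC_add !trmxC_mul rho_herm.
  by rewrite fmorphV rmorph_nat addrC.
have : sld r theta a \is hermsymmx /\
    2^-1 *: (r theta *m sld r theta a + sld r theta a *m r theta) = D a.
  apply: (@xgetPex _ 0 [set L : op | L \is hermsymmx /\
      2^-1 *: (r theta *m L + L *m r theta) = D a]%classic).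
  by exists L; split; [apply/hermsymmxP|rewrite r_theta].
by rewrite r_theta => -[/hermsymmxP ? /inj].
Qed.

(* tr (rho_a rho^-1 rho_b) = <<rho_a| L^-1 |rho_b>>: the Right Fisher matrix is
   the Gram matrix of the Left superoperator, and vice versa. *)
Definition dual_variant X :=
  match X with Sym => Sym | Left => Right | Right => Left end.

(** In each case [ket (D b)] is written as a superoperator applied to an explicit operator, so that
    the inverse cancels: S at the logarithmic derivative, R at [D b *m invmx rho], L at
    [invmx rho *m D b]. *)
Lemma qfisherE X : qfisher r theta X =
  (frame D)^t* *m Jsuper rho (dual_variant X) *m frame D.
Proof.
have unit_rho := posdefmx_unit rhoD.1.
apply/matrixP => a b; rewrite frame_gramE [LHS]mxE r_theta; case: X => /=.
- have [La eLa] := sldP a; have [Lb eLb] := sldP b.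
  have -> : bra (D a) *m Jsuper rho Sym = bra (sld r theta a).
    by rewrite -[RHS]trmxC_ket eLa trmxC_mul trmxC_ket Jsuper_herm.
  have -> : ket (D b) = ket (2^-1 *: (rho *m sld r theta b + sld r theta b *m rho)).
    by rewrite -Ssuper_ket eLb SsuperJ.
  by rewrite braketE [RHS]mxE eqxx mulr1n La mxtrace_anticomm.
- have -> : ket (D b) = Rsuper rho *m ket (D b *m invmx rho).
    by rewrite Rsuper_ket mulmxKV.
  rewrite mulmxA -(mulmxA _ (Jsuper _ _)) (JSop rhoD Right) mulmx1 braketE.
  by rewrite pderiv_herm mxE eqxx mulr1n mulmxA.
- have -> : ket (D b) = Lsuper rho *m ket (invmx rho *m D b).
    by rewrite Lsuper_ket mulKVmx.
  rewrite mulmxA -(mulmxA _ (Jsuper _ _)) (JSop rhoD Left) mulmx1 braketE.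
  by rewrite pderiv_herm mxE eqxx mulr1n mulmxA.
Qed.

(** Traces of products of two Hermitian operators are real, so the probabilities and their
    derivatives, seen in C, are the pairings <<rho|A_j>> and <<D_a|A_j>>. *)
Lemma fisher_infoE (I : finType) (A : I -> op) : simple_povm A ->
  map_mx (real_complex R) (fisher_info r theta A) =
  (frame D)^t* *m Fsuper rho A *m frame D.
Proof.
move=> simpleA; have A_herm j : (A j)^t* = A j.
  by case: simpleA => -[psdA _] _ _; exact/psdmx_herm.
have A_neq0 j : A j != 0 by case: simpleA.
have probC j : (outcome_prob r (A j) theta)%:C = \tr (rho *m A j).
  by rewrite /outcome_prob r_theta RRe_real// tr_herm_real.
have derivC a j :
    ('D_(dir a) (outcome_prob r (A j)) theta)%:C = \tr (D a *m A j).
  by rewrite derive_outcome_prob RRe_real// tr_herm_real// pderiv_herm.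
have braC a j : bra (D a) *m ket (A j) = (\tr (D a *m A j))%:M.
  by rewrite braketE pderiv_herm.
have ketC a j : bra (A j) *m ket (D a) = (\tr (D a *m A j))%:M.
  by rewrite braketE A_herm mxtrace_mulC.
apply/matrixP => a b.
rewrite frame_gramE FsuperE// [LHS]mxE [in LHS]mxE rmorph_sum /=.
rewrite mulmx_sumr mulmx_suml summxE.
rewrite (eq_bigl predT) => [|j]; last by rewrite A_neq0.
apply: eq_bigr => j _.
move: (probC j) (derivC a j) (derivC b j) (braC a j) (ketC b j).
move: (outcome_prob r (A j) theta) (D a) (D b) => p Da Db.
move: ('D_(dir a) _ _) ('D_(dir b) _ _) => x y pE xE yE braE ketE.
rewrite !rmorphM fmorphV /= pE xE yE.
rewrite -scalemxAr -scalemxAl (mulmxA (bra Da)).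
rewrite -(mulmxA _ (bra (A j))) braE ketE.
by rewrite mul_scalar_mx !mxE eqxx mulr1n mulrA.
Qed.

Lemma metric_fisher_sharp (d_gt0 : (0 < d)%N) X (I : finType) (A : I -> op) :
  simple_povm A ->
  projector (metric_fisher r theta X A) <-> sharp rho A (dual_variant X).
Proof.
move=> simpleA; rewrite /metric_fisher qfisherE fisher_infoE//.
apply: frame_sharp => //.
- exact: pderiv_herm.
- exact: pderiv_traceless.
- exact: pderiv_free.
Qed.

End Parametrization.

(** * Existence of a parametrization *)

Section PosdefPerturbation.
Variable R : realType.
Local Notation C := R[i].

(** A crude entrywise estimate: each of the n^2 terms is at most [e] times the squared norm of
    [v]. *)
Lemma norm_quadratic_form n (H : 'M[C]_n) (e : C) (v : 'cV[C]_n) :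
  0 <= e -> (forall i j, `|H i j| <= e) ->
  `|(v^t* *m H *m v) 0 0| <= e * (n * n)%:R * (v^t* *m v) 0 0.
Proof.
move=> e0 He.
have vvE : (v^t* *m v) 0 0 = \sum_i `|v i 0| ^+ 2.
  by rewrite mxE; apply: eq_bigr => i _; rewrite !mxE normCK mulrC.
have vv0 : 0 <= (v^t* *m v) 0 0.
  by rewrite vvE sumr_ge0// => i _; rewrite exprn_ge0.
have v_le i : `|v i 0| <= sqrtC ((v^t* *m v) 0 0).
  rewrite -(@ler_pXn2r _ 2) ?nnegrE ?sqrtC_ge0// sqrtCK vvE (bigD1 i)//= lerDl.
  by rewrite sumr_ge0// => j _; rewrite exprn_ge0.
have term i j : `|v i 0| * `|v j 0| <= (v^t* *m v) 0 0.
  by rewrite -[leRHS]sqrtCK expr2 ler_pM.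
rewrite [in leLHS]mxE (le_trans (ler_norm_sum _ _ _))//.
have -> : e * (n * n)%:R * (v^t* *m v) 0 0 =
    \sum_(j < n) \sum_(i < n) e * (v^t* *m v) 0 0.
  by rewrite !sumr_const !card_ord -!mulrnA -[RHS]mulr_natr mulrAC.
apply: ler_sum => j _; rewrite mxE normrM.
rewrite (le_trans (ler_wpM2r (normr_ge0 _) (ler_norm_sum _ _ _)))//.
rewrite mulr_suml; apply: ler_sum => i _.
rewrite !mxE normrM norm_conjC mulrAC mulrC; apply: ler_pM => //.
by rewrite (le_trans (term i j))// mxE.
Qed.

(** The form of [H] is real and at least -e n^2 times the squared norm of [v], which the scalar part
    outweighs. *)
Lemma posdefmx_perturb n (H : 'M[C]_n) (c e : C) : H^t* = H -> 0 <= e ->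
  (forall i j, `|H i j| <= e) -> e * (n * n)%:R < c -> posdefmx (c%:M + H).
Proof.
move=> hH e0 He ec v v0.
have vv : 0 < (v^t* *m v) 0 0.
  rewrite -trace_mx11 lt_def mxtrace_gram_ge0 andbT.
  by apply: contra_neq v0; exact: mxtrace_gram_eq0.
have qreal : (v^t* *m H *m v) 0 0 \is Num.real.
  apply/CrealP; transitivity ((v^t* *m H *m v)^t* 0 0); first by rewrite !mxE.
  by rewrite !trmxC_mul trmxCK hH mulmxA.
have := real_lerNnormlW qreal (norm_quadratic_form v e0 He).
rewrite mulmxDr mulmxDl mul_mx_scalar -scalemxAl => h.
rewrite [X in 0 < X]mxE [X in X + _]mxE.
apply: lt_le_trans (lerD (lexx _) h).
by rewrite -mulrBl mulr_gt0// subr_gt0.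
Qed.

End PosdefPerturbation.

(** * Affine matrix-valued functions of real parameters *)

Section AffineMaps.
Variables (R : realType) (m n g : nat).
Variables (c : 'M[R]_(m, n)) (M : 'I_g -> 'M[R]_(m, n)).

Definition affine_mx (t : 'rV[R]_g) : 'M[R]_(m, n) := c + \sum_a t 0 a *: M a.

Lemma differentiable_affine_mx t : differentiable affine_mx t.
Proof.
have h := differentiableD (@differentiable_cst R 'rV[R]_g _ c t)
  (differentiable_sum
    (fun a => differentiableZl (M a) (differentiable_coord t 0 a))).
move: h; set f := (X in differentiable X _).
suff -> : f = affine_mx by [].
by apply/funext => u; rewrite /f /affine_mx; congr (_ + _); rewrite fct_sumE.
Qed.

(** The difference quotient is constant for nonzero increments. *)
Lemma derive_affine_mx t b : 'D_(delta_mx 0 b) affine_mx t = M b.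
Proof.
rewrite /derive; apply: lim_near_cst => //.
near=> h.
have h0 : h != 0 by near: h; exact: nbhs_dnbhs_neq.
rewrite /affine_mx /= opprD addrACA subrr add0r -sumrB (bigD1 b)//= big1.
  by rewrite addr0 -scalerBl !mxE !eqxx mulr1 addrK scalerA mulVf// scale1r.
by move=> a /negPf ab; rewrite -scalerBl !mxE ab mulr0 add0r subrr scale0r.
Unshelve. all: by end_near. Qed.

End AffineMaps.

(** * An affine parametrization around the maximally mixed state *)

Section HermitianParametrization.
Variables (R : realType) (d : nat).
Local Notation C := R[i].
Local Notation op := 'M[C]_d.
Local Notation g := (d ^ 2).-1.
Hypothesis d_gt0 : (0 < d)%N.

(* A bijection of the real matrices onto the Hermitian ones. *)
Definition herm_of (X : 'M[R]_d) : op :=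
  map_mx (real_complex R) (X + X^T) +
  'i *: map_mx (real_complex R) (X - X^T).

Lemma herm_of_sum (c : 'I_g -> R) (X : 'I_g -> 'M[R]_d) :
  \sum_a (c a)%:C *: herm_of (X a) = herm_of (\sum_a c a *: X a).
Proof.
have herm_ofD Y Z : herm_of (Y + Z) = herm_of Y + herm_of Z.
  rewrite /herm_of linearD /= (addrACA Y Z Y^T) opprD (addrACA Y Z (- Y^T)).
  by rewrite !map_mxD !scalerDr [LHS]addrACA.
have herm_ofZ x Y : herm_of (x *: Y) = x%:C *: herm_of Y.
  rewrite /herm_of linearZ /= -scalerDr -scalerBr !map_mxZ.
  by rewrite scalerDr !scalerA mulrC.
have herm_of0 : herm_of 0 = 0.
  by rewrite /herm_of trmx0 addr0 subr0 map_mx0 scaler0 addr0.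
rewrite (big_morph _ herm_ofD herm_of0); apply: eq_bigr => a _.
by rewrite herm_ofZ.
Qed.

Lemma herm_of_herm X : (herm_of X)^t* = herm_of X.
Proof.
apply/matrixP => i j; rewrite !mxE; apply/eqP; rewrite eq_complex /=.
by rewrite !(mul0r, mul1r, oppr0, addr0, add0r, subr0) addrC eqxx opprB eqxx.
Qed.

Lemma mxReD (M N : op) : mxRe (M + N) = mxRe M + mxRe N.
Proof. by apply/matrixP => i j; rewrite !mxE raddfD. Qed.

Lemma mxImD (M N : op) : mxIm (M + N) = mxIm M + mxIm N.
Proof. by apply/matrixP => i j; rewrite !mxE raddfD. Qed.

Lemma mxRe_scalar x : mxRe (x%:C%:M : op) = x%:M.
Proof. by apply/matrixP => i j; rewrite !mxE raddfMn. Qed.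

Lemma mxIm_scalar x : mxIm (x%:C%:M : op) = 0.
Proof. by apply/matrixP => i j; rewrite !mxE raddfMn /= mul0rn. Qed.

Lemma mxRe_herm_of X : mxRe (herm_of X) = X + X^T.
Proof.
by apply/matrixP => i j; rewrite !mxE /= !(mul0r, mul1r, oppr0, addr0, subr0).
Qed.

Lemma mxIm_herm_of X : mxIm (herm_of X) = X - X^T.
Proof.
by apply/matrixP => i j; rewrite !mxE /= !(mul0r, mul1r, oppr0, addr0, add0r).
Qed.

Lemma mxtrace_herm_of X : \tr X = 0 -> \tr (herm_of X) = 0.
Proof.
move=> trX; rewrite mxtraceD mxtraceZ !trace_map_mx mxtraceD raddfB /=.
by rewrite mxtrace_tr trX subrr addr0 mulr0 addr0.
Qed.

(** The rows of [N] are a basis of the kernel of the trace. This linear form takes the value [d] at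
    the identity, so it is nonzero and its kernel has dimension d^2 - 1. *)
Lemma traceless_basis : exists N : 'M[R]_(g, d * d),
  row_free N /\ forall u : 'rV_g, \tr (vec_mx (u *m N)) = 0.
Proof.
pose f (u : 'rV[R]_(d * d)) : 'rV[R]_1 := (\tr (vec_mx u))%:M.
have lf : linear f.
  by move=> a u v; rewrite /f linearP mxtraceD mxtraceZ raddfD /= scale_scalar_mx.
pose fl : {linear 'rV[R]_(d * d) -> 'rV[R]_1} :=
  HB.pack f (GRing.isLinear.Build _ _ _ _ f lf).
pose tau : 'cV[R]_(d * d) := lin1_mx fl.
have tauE u : u *m tau = (\tr (vec_mx u))%:M by rewrite /tau mul_rV_lin1.
have rk : \rank (kermx tau) = g.
  rewrite mxrank_ker -mulnn -subn1; congr (_ - _)%N; apply/eqP.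
  rewrite eqn_leq rank_leq_col lt0n mxrank_eq0; apply/eqP => tau0.
  have := tauE (mxvec 1%:M); rewrite tau0 mulmx0 mxvecK mxtrace1.
  move/matrixP/(_ 0 0)/eqP; rewrite !mxE mulr1n eq_sym pnatr_eq0.
  by rewrite -leqn0 leqNgt d_gt0.
have rf := row_base_free (kermx tau).
have ker : row_base (kermx tau) *m tau = 0.
  by apply/sub_kermxP; rewrite eq_row_base.
move: (row_base (kermx tau)) rf ker; rewrite rk => N rf ker.
exists N; split=> // u; have := tauE (u *m N).
by rewrite -mulmxA ker mulmx0 => /matrixP/(_ 0 0); rewrite !mxE mulr1n.
Qed.

Lemma density_maximally_mixed : density ((d%:R^-1)%:M : op).
Proof.
have d0 : d%:R != 0 :> C by rewrite pnatr_eq0 -lt0n.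
split; last by rewrite mxtrace_scalar -[LHS]mulr_natr mulVf.
rewrite -[_%:M]addr0; apply: (@posdefmx_perturb _ _ _ _ 0) => //.
- by rewrite trmx0 map_mx0.
- by move=> i j; rewrite mxE normr0.
- by rewrite mul0r invr_gt0 ltr0n.
Qed.

(** A basis of traceless real matrices is carried by [herm_of] to traceless Hermitian ones and
    added, with the parameters as coefficients, to the maximally mixed state. Positivity persists
    near the origin. *)
Lemma exists_parametrization : exists (r : 'rV[R]_g -> op) theta,
  parametrization r theta (d%:R^-1)%:M.
Proof.
have [N [Nfree trN]] := traceless_basis.
pose X (t : 'rV[R]_g) : 'M[R]_d := vec_mx (t *m N).
pose r t : op := (d%:R^-1)%:M + herm_of (X t).
pose Re_a a := X (delta_mx 0 a) + (X (delta_mx 0 a))^T.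
pose Im_a a := X (delta_mx 0 a) - (X (delta_mx 0 a))^T.
have XE t : X t = \sum_a t 0 a *: X (delta_mx 0 a).
  rewrite /X {1}(row_sum_delta t) mulmx_suml linear_sum; apply: eq_bigr => a _.
  by rewrite -scalemxAl linearZ.
have XT t : (X t)^T = \sum_a t 0 a *: (X (delta_mx 0 a))^T.
  by rewrite {1}XE linear_sum; apply: eq_bigr => a _; rewrite linearZ.
have dC : (d%:R^-1 : C) = (d%:R^-1)%:C by rewrite fmorphV rmorph_nat.
have sumD t : X t + (X t)^T = \sum_a t 0 a *: Re_a a.
  by rewrite {1}XE XT -big_split; apply: eq_bigr => a _; rewrite scalerDr.
have sumB t : X t - (X t)^T = \sum_a t 0 a *: Im_a a.
  by rewrite {1}XE XT -sumrB; apply: eq_bigr => a _; rewrite scalerBr.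
have ReE : @mxRe R d \o r = affine_mx (d%:R^-1)%:M Re_a.
  by apply/funext => t; rewrite /= mxReD mxRe_herm_of dC mxRe_scalar sumD.
have ImE : @mxIm R d \o r = affine_mx 0 Im_a.
  by apply/funext => t; rewrite /= mxImD mxIm_herm_of dC mxIm_scalar sumB.
have X0 : X 0 = 0 by rewrite /X mul0mx linear0.
exists r, 0; split.
  rewrite /r X0 /herm_of trmx0 addr0 subr0.
  by rewrite map_mx0 scaler0 !addr0.
have pderivE t a : pderiv r t a = herm_of (X (delta_mx 0 a)).
  by rewrite /pderiv ReE ImE !derive_affine_mx.
have trX t : \tr (X t) = 0 by exact: trN.
(* Real and imaginary parts below [e] bound the entries of the perturbation by 2e, and 2e d^2 =
   1/(2d) is below the scalar 1/d, as [posdefmx_perturb] requires. *)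
pose e : R := (d%:R * (d * d)%:R *+ 4)^-1.
have e0 : 0 < e.
  by rewrite invr_gt0 pmulrn_lgt0// mulr_gt0// ltr0n ?muln_gt0 d_gt0.
have near_pos : \forall t \near (0 : 'rV[R]_g), posdefmx (r t).
  have near_small (f : 'rV[R]_g -> 'M[R]_d) : f 0 = 0 ->
      {for 0, continuous f} ->
      \forall t \near (0 : 'rV[R]_g), forall i j, `|f t i j| < e.
    move=> f0 /(cvgr_dist_lt _)/(_ _ e0); rewrite f0.
    apply: filterS => t; rewrite sub0r normrN => ft i j.
    (* The norm on matrices is the maximum of the absolute values of the entries. *)
    apply: le_lt_trans ft; rewrite [leRHS]/Num.Def.normr /= mx_normrE.
    exact: (le_bigmax _ (fun ij => `|f t ij.1 ij.2|) (i, j)).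
  have aff c M : {for 0, continuous (@affine_mx R d d g c M)}.
    exact/differentiable_continuous/differentiable_affine_mx.
  have z M : @affine_mx R d d g 0 M 0 = 0.
    by rewrite /affine_mx add0r big1// => a _; rewrite mxE scale0r.
  have near1 := near_small _ (z Re_a) (aff _ _).
  have near2 := near_small _ (z Im_a) (aff _ _).
  apply: filterS2 near1 near2 => t h1 h2.
  apply: (@posdefmx_perturb _ _ _ _ ((e *+ 2)%:C)).
  - exact: herm_of_herm.
  - by rewrite ler0c mulrn_wge0// ltW.
  - move=> i j; have {}h1 := ltW (h1 i j); have {}h2 := ltW (h2 i j).
    rewrite /affine_mx add0r -sumD in h1; rewrite /affine_mx add0r -sumB in h2.
    rewrite /herm_of mxE [X in `|_ + X|]mxE (le_trans (ler_normD _ _))//.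
    rewrite normrM normCi mul1r [X in `|X| + _]mxE [X in _ + `|X|]mxE.
    rewrite mulr2n rmorphD /= !normc_def /= !expr0n /= !addr0 !sqrtr_sqr.
    by rewrite lerD// lecR.
  - rewrite dC -(rmorph_nat (real_complex R)) -rmorphM ltcR /e.
    have dd0 : 0 < (d * d)%:R :> R by rewrite ltr0n muln_gt0 d_gt0.
    have dR0 : 0 < d%:R :> R by rewrite ltr0n.
    have -> : (d%:R * (d * d)%:R *+ 4)^-1 *+ 2 * (d * d)%:R = d%:R^-1 / 2 :> R.
      by field; rewrite !gt_eqF.
    by rewrite gtr_pMr ?invr_gt0// invf_lt1 ?ltr1n.
apply: filterS near_pos => t pos; split.
- split=> //; rewrite /r mxtraceD mxtrace_herm_of// addr0.
  exact: density_maximally_mixed.2.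
- by rewrite ReE ImE; split; exact: differentiable_affine_mx.
- move=> c sum0 a.
  pose u : 'rV[R]_g := \row_b c b.
  (* The real part X + X^T and the imaginary part X - X^T then vanish, hence so does X, and the rows
     of [N] are independent. *)
  have : herm_of (X u) = 0.
    rewrite -[RHS]sum0; under eq_bigr do rewrite pderivE.
    by rewrite herm_of_sum XE; congr herm_of; apply: eq_bigr => b _; rewrite mxE.
  move=> hX; have X2 : X u + (X u)^T = 0.
    by rewrite -mxRe_herm_of hX; apply/matrixP => i j; rewrite !mxE.
  have X3 : X u - (X u)^T = 0.
    by rewrite -mxIm_herm_of hX; apply/matrixP => i j; rewrite !mxE.
  have Xu : X u = 0.
    have : X u *+ 2 = 0 by rewrite mulr2n -{2}[X u](subrK (X u)^T) X3 add0r X2.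
    by move/eqP; rewrite -scaler_nat scaler_eq0 pnatr_eq0 /= => /eqP.
  have : u *m N = 0.
    by move/(congr1 mxvec): Xu; rewrite vec_mxK linear0.
  rewrite -(mul0mx _ N) => /(row_free_inj Nfree) /rowP/(_ a).
  by rewrite !mxE.
Qed.

End HermitianParametrization.

Local Close Scope complex_scope.
Local Close Scope sesquilinear_scope.

Theorem theorem4 (R : realType) (d : nat) (d_gt0 : (0 < d)%N)
    (I : finType) (A : I -> 'M[R[i]%C]_d) (simpleA : simple_povm A) :
  [<->
    pvm A;
    universally_fisher_sharp A;
    exists2 rho, density rho &
      exists r theta, parametrization r theta rho /\ fisher_sharp r theta A;
    forall rho, density rho -> forall X : variant,
      [/\ forall r theta, parametrization r theta rho ->
            projector (metric_fisher r theta X A),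
          projector (metric_Fbar rho X A)
        & projector (metric_F rho X A)];
    exists2 rho, density rho & exists X : variant,
      [\/ exists r theta, parametrization r theta rho /\
            projector (metric_fisher r theta X A),
          projector (metric_Fbar rho X A)
        | projector (metric_F rho X A)]].
Proof.
(* The maximally mixed state is the witness for both existential statements. *)
have mixedD := density_maximally_mixed R d_gt0.
tfae.
- move=> pvmA rho rhoD r theta param.
  apply/(metric_fisher_sharp param d_gt0 Sym simpleA).
  exact: (pvm_sharp rhoD simpleA).
(* Universal sharpness quantifies over parametrizations, so passing to an existential statement
   takes an actual one. *)
- move=> sharpA; have [r [theta param]] := exists_parametrization R d_gt0.
  by exists (d%:R^-1)%:M => //; exists r, theta; split; last exact: (sharpA _ mixedD _ _ param).
- move=> [rho rhoD [r [theta [param]]]].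
  move=> /(metric_fisher_sharp param d_gt0 Sym simpleA)/(sharp_pvm rhoD simpleA).
  move=> pvmA sigma sigmaD X; split=> [s eta paramS||].
  + apply/(metric_fisher_sharp paramS d_gt0 X simpleA).
    exact: (pvm_sharp sigmaD simpleA).
  + apply/(metric_Fbar_sharp d_gt0 sigmaD simpleA).
    exact: (pvm_sharp sigmaD simpleA).
  + apply/(metric_F_sharp sigmaD simpleA).
    exact: (pvm_sharp sigmaD simpleA).
(* The third alternative is a statement about the state alone and calls for no parametrization. *)
- move=> proj; exists (d%:R^-1)%:M => //; exists Sym; apply: Or33.
  by have [] := proj _ mixedD Sym.
- move=> [rho rhoD [X [[r [theta [param]]]||]]].
  + by move=> /(metric_fisher_sharp param d_gt0 X simpleA)/(sharp_pvm rhoD simpleA).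
  + by move=> /(metric_Fbar_sharp d_gt0 rhoD simpleA)/(sharp_pvm rhoD simpleA).
  + by move=> /(metric_F_sharp rhoD simpleA)/(sharp_pvm rhoD simpleA).
Qed.
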